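(* Let $n\ge1$. For each integer $t\ge1$, $\operatorname{las}'_t(\mathbb{R}^n)$ is an upper bound on sphere packing, i.e., $\delta_{\operatorname{pack},n}\le\operatorname{las}'_t(\mathbb{R}^n)$, and \[ \lim_{t\to\infty}\operatorname{las}'_t(\mathbb{R}^n)=\delta_{\operatorname{pack},n}. \]
   Context: For bounded $C\subseteq\mathbb{R}^n$, $\operatorname{pack}(C)$ is the maximal size of a subset of $C$ whose distinct points are at distance at least $2$ from each other, and $\delta_{\operatorname{pack},n}=\lim_{k\to\infty}\operatorname{pack}(2^k[0,1]^n)/2^{kn}$ (the limit exists; it is the optimal sphere packing density in $\mathbb{R}^n$ divided by the volume of a unit ball). Call a finite subset of $\mathbb{R}^n$ independent if its distinct points are at distance at least $2$ from each other. Let $I_{=k,\mathbb{R}^n}$ be the set of independent sets of size exactly $k$, topologized as a subset of the quotient of $(\mathbb{R}^n)^k$ under $(v_1,\dots,v_k)\mapsto\{v_1,\dots,v_k\}$ (with $I_{=0,\mathbb{R}^n}=\{\emptyset\}$), and let $I_{t,\mathbb{R}^n}$ be the disjoint union of $I_{=k,\mathbb{R}^n}$ for $k=0,\dots,t$, with the disjoint union topology. For $f\colon I_{t,\mathbb{R}^n}\times I_{t,\mathbb{R}^n}\to\mathbb{R}$ and $S\in I_{2t,\mathbb{R}^n}$, set $A_tf(S)=\sum f(J,J')$, the sum being over all ordered pairs $(J,J')$ with $J,J'\in I_{t,\mathbb{R}^n}$ and $J\cup J'=S$. A kernel $K\colon I_{t,\mathbb{R}^n}\times I_{t,\mathbb{R}^n}\to\mathbb{R}$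 is positive semidefinite if $K(J,J')=K(J',J)$ and $\sum_{J,J'\in S}w_Jw_{J'}K(J,J')\ge0$ for every finite $S\subseteq I_{t,\mathbb{R}^n}$ and all real weights $w_J$. $\mathbb{R}^n$ acts on $I_{2t,\mathbb{R}^n}$, and hence on Radon measures on it, by translation. If $\mu$ is a translation-invariant Radon measure on $I_{2t,\mathbb{R}^n}$, its restriction to $I_{=1,\mathbb{R}^n}$ (identified with $\mathbb{R}^n$) is a multiple of Lebesgue measure, and $\widehat{\mu}(0)$ denotes this multiple. $\operatorname{las}'_t(\mathbb{R}^n)$ is the supremum of $\widehat{\mu}(0)$ over all nonnegative translation-invariant Radon measures $\mu$ on $I_{2t,\mathbb{R}^n}$ such that $\mu(\{\emptyset\})=1$ and $A_t^*\mu$ is positive semidefinite, meaning that $\int_{I_{2t,\mathbb{R}^n}}A_tK\,d\mu\ge0$ for every continuous, compactly supported, positive semidefinite kernel $K\colon I_{t,\mathbb{R}^n}\times I_{t,\mathbb{R}^n}\to\mathbb{R}$. *)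

(* Defs.v *)
From HB Require Import structures.
From mathcomp Require Import all_boot all_order all_algebra finmap.
From mathcomp Require Import all_classical all_reals all_analysis.

Set Implicit Arguments.
Unset Strict Implicit.
Unset Printing Implicit Defensive.

Import Order.TTheory GRing.Theory Num.Theory.
Import numFieldNormedType.Exports.

Local Open Scope classical_set_scope.
Local Open Scope ring_scope.

(* The norm that the library puts on 'rV[R]_n is the sup norm, hence this
   explicit Euclidean distance. *)
Definition edist (R : realType) (n : nat) (x y : 'rV[R]_n) : R :=
  Num.sqrt (\sum_(i < n) (x 0 i - y 0 i) ^+ 2).

Definition independent (R : realType) (n : nat) (S : {fset 'rV[R]_n}) : Prop :=
  forall x y, x \in S -> y \in S -> x != y -> 2 <= edist x y.

(* For bounded C every independent subset is finite and their sizes are bounded,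
   so this real supremum of natural numbers is a maximum. *)
Definition pack (R : realType) (n : nat) (C : set 'rV[R]_n) : R :=
  sup [set (#|` S|)%:R |
        S in [set S : {fset 'rV[R]_n} | [set` S] `<=` C /\ independent S]].

Definition unit_cube (R : realType) (n : nat) : set 'rV[R]_n :=
  [set x | forall i, 0 <= x 0 i <= 1].
Arguments unit_cube : clear implicits.

Definition delta_pack (R : realType) (n : nat) : R :=
  limn (fun k : nat =>
    pack [set 2 ^+ k *: x | x in unit_cube R n] / 2 ^+ (k * n)).

Record indepset (R : realType) (n t : nat) := IndepSet {
  indepset_val :> {fset 'rV[R]_n} ;
  _ : `[< independent indepset_val >] && (#|` indepset_val| <= t)%N }.

HB.instance Definition _ (R : realType) (n t : nat) :=
  [isSub for @indepset_val R n t].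
HB.instance Definition _ (R : realType) (n t : nat) :=
  [Choice of indepset R n t by <:].

Lemma indepset0_subproof (R : realType) (n t : nat) :
  `[< independent (fset0 : {fset 'rV[R]_n}) >] &&
  (#|` (fset0 : {fset 'rV[R]_n})| <= t)%N.
Proof. by rewrite cardfs0 andbT; apply/asboolP => x y; rewrite in_fset0. Qed.

Definition indepset0 (R : realType) (n t : nat) : indepset R n t :=
  IndepSet (indepset0_subproof R n t).

HB.instance Definition _ (R : realType) (n t : nat) :=
  isPointed.Build (indepset R n t) (indepset0 R n t).

(* (R^n)^k is the space of k x n matrices, whose rows are the k vectors; its
   quotient under (v_1, ..., v_k) |-> {v_1, ..., v_k} is realized as a set of
   finite sets, with V open when its preimage is. *)
Definition quotient_fset_open (R : realType) (n k : nat)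
    (V : set {fset 'rV[R]_n}) : Prop :=
  open [set v : 'M[R]_(k, n) | V [fset row i v | i in 'I_k]%fset].

(* Disjoint union topology: U is open iff for every k its part of cardinality k
   is the trace of an open set of the quotient of (R^n)^k. *)
Definition indepset_open (R : realType) (n t : nat) : set_system (indepset R n t) :=
  [set U | forall k, exists V : set {fset 'rV[R]_n},
    quotient_fset_open k V /\
    forall S : indepset R n t, #|` S| = k -> (U S <-> V S)].

Lemma indepset_openT (R : realType) (n t : nat) :
  @indepset_open R n t setT.
Proof. by move=> k; exists setT; split; [exact: openT | by []]. Qed.

Lemma indepset_openI (R : realType) (n t : nat) :
  setI_closed (@indepset_open R n t).
Proof.
move=> A B oA oB k.
have [V [oV AV]] := oA k; have [W [oW BW]] := oB k.
exists (V `&` W); split; first exact: openI.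
by move=> S Sk; rewrite /setI /= AV // BW.
Qed.

Lemma indepset_open_bigU (R : realType) (n t : nat) (I : Type)
    (f : I -> set (indepset R n t)) :
  (forall i, indepset_open (f i)) -> indepset_open (\bigcup_i f i).
Proof.
move=> of_ k.
have /choice[V VP] := fun i => of_ i k.
exists (\bigcup_i V i); split.
  rewrite /quotient_fset_open.
  have -> : [set v : 'M[R]_(k, n) |
      (\bigcup_i V i) [fset row i v | i in 'I_k]%fset] =
      \bigcup_i [set v : 'M[R]_(k, n) | V i [fset row i v | i in 'I_k]%fset].
    by apply/seteqP; split.
  by apply: bigcup_open => i _; have [] := VP i.
by move=> S Sk; split=> -[i _ ?]; exists i => //; have [_ /(_ S Sk) []] := VP i; auto.
Qed.

HB.instance Definition _ (R : realType) (n t : nat) :=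
  isOpenTopological.Build (indepset R n t)
    (@indepset_openT R n t) (@indepset_openI R n t) (@indepset_open_bigU R n t).

Lemma translate_subproof (R : realType) (n t : nat) (v : 'rV[R]_n)
    (S : indepset R n t) :
  `[< independent [fset (x + v)%R | x in (S : {fset 'rV[R]_n})]%fset >] &&
  (#|` [fset (x + v)%R | x in (S : {fset 'rV[R]_n})]%fset| <= t)%N.
Proof.
case: S => S /= /andP[/asboolP indS St]; apply/andP; split; last first.
  by rewrite (leq_trans _ St)// card_imfset //; exact: addIr.
apply/asboolP => _ _ /imfsetP[x /= xS ->] /imfsetP[y /= yS ->] xy.
have -> : edist (x + v) (y + v) = edist x y.
  by rewrite /edist; congr Num.sqrt; apply: eq_bigr => i _;
     rewrite !mxE opprD addrACA subrr addr0.
by apply: indS => //; apply: contra_neq xy => ->.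
Qed.

Definition translate (R : realType) (n t : nat) (v : 'rV[R]_n)
    (S : indepset R n t) : indepset R n t :=
  IndepSet (translate_subproof v S).

Notation borel T := (g_sigma_algebraType (@open T)).

Definition radon (R : realType) (T : ptopologicalType)
    (mu : {measure set (borel T) -> \bar R}) : Prop :=
  [/\ forall K : set T, compact K -> (mu K < +oo)%E,
      forall B : set (borel T), measurable B ->
        mu B = ereal_inf [set mu U | U in [set U : set T | open U /\ B `<=` U]]
    & forall U : set T, open U ->
        mu U = ereal_sup [set mu K | K in [set K : set T | compact K /\ K `<=` U]]].

Definition translation_invariant (R : realType) (n t : nat)
    (mu : {measure set (borel (indepset R n t)) -> \bar R}) : Prop :=
  forall (v : 'rV[R]_n) (B : set (borel (indepset R n t))),
    measurable B -> mu (@translate R n t v @` B) = mu B.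

(* n-fold product of the one-dimensional Lebesgue measure: the library defines
   (m1 \x m2) A as the m1-integral of the m2-measure of the slices of A, and this
   iterates that formula.  It is Lebesgue measure on the Borel sets. *)
Fixpoint lebesgue_rV (R : realType) (n : nat) : set 'rV[R]_n -> \bar R :=
  match n return set 'rV[R]_n -> \bar R with
  | 0 => fun A => (\1_A 0)%:E
  | m.+1 => fun A =>
      (\int[@lebesgue_measure R]_x
         lebesgue_rV [set y : 'rV[R]_m |
           A (row_mx (x%:M : 'rV[R]_1) y : 'rV[R]_(1 + m))])%E
  end.

(* For a translation-invariant Radon measure exactly one such c exists, so the
   default value 0 is not used. *)
Definition hat0 (R : realType) (n t : nat)
    (mu : {measure set (borel (indepset R n t)) -> \bar R}) : R :=
  xget 0 [set c : R | forall B : set (borel 'rV[R]_n), measurable B ->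
    mu [set S : indepset R n t |
         exists2 x, B x & (S : {fset 'rV[R]_n}) = [fset x]%fset] =
    (c%:E * lebesgue_rV B)%E].

(* For each S there are finitely many pairs (J, J'), so the finitely supported
   sum is the plain sum. *)
Definition A_op (R : realType) (n t : nat)
    (f : indepset R n t * indepset R n t -> R) (S : indepset R n (2 * t)) : R :=
  \sum_(p \in [set p : indepset R n t * indepset R n t |
       (p.1 `|` p.2)%fset = S :> {fset 'rV[R]_n}]) f p.

Definition psd_kernel (R : realType) (T : choiceType) (K : T * T -> R) : Prop :=
  (forall J J', K (J, J') = K (J', J)) /\
  (forall (S : {fset T}) (w : T -> R),
     0 <= \sum_(J <- S) \sum_(J' <- S) w J * w J' * K (J, J')).

Definition compactly_supported (R : realType) (T : topologicalType)
    (f : T -> R) : Prop :=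
  compact (closure [set x | f x != 0]).

Definition las_feasible (R : realType) (n t : nat)
    (mu : {measure set (borel (indepset R n (2 * t))) -> \bar R}) : Prop :=
  [/\ radon mu,
      translation_invariant mu,
      mu [set indepset0 R n (2 * t)] = 1%E
    & forall K : indepset R n t * indepset R n t -> R,
        continuous K -> compactly_supported K -> psd_kernel K ->
        (0 <= \int[mu]_S (A_op K S)%:E)%E].

Definition las' (R : realType) (n t : nat) : \bar R :=
  ereal_sup [set (hat0 mu)%:E |
    mu in [set mu : {measure set (borel (indepset R n (2 * t))) -> \bar R} |
            las_feasible mu]].

(* Main.v *)
(* Upper bound.  If N bounds the packings of a cube, a function phi with
   0 <= phi <= 1 supported in that cube has sum at most N over independent sets,
   so h, the Moebius inverse of S |-> sqrt (N - sum of phi over S), is defined;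
   it vanishes on sets leaving the cube, which include all independent sets of
   more than N points.  For t >= N the kernel h(J) h(J') therefore has A_t-image
   N on the empty set, -phi(x) on {x} and 0 on larger sets.  Positivity of
   A_t^* mu then gives \hat mu(0) * \int phi <= N.

   Lower bound.  The periodic packing S + (2^k + 2) Z^n built from a packing S of
   2^k [0,1]^n, translated uniformly at random, induces a feasible measure with
   \hat mu(0) = |S| / (2^k + 2)^n.

   With D_k = pack(2^k [0,1]^n) / 2^(kn), the two bounds give
   D_k <= las'_t (1 + 2 / 2^k)^n for every t >= 1 and las'_t <= D_j for t large,
   whence both the convergence of D_k and that of las'_t to its limit. *)

(* The square root comes from the shape of A_t: summed over the subsets of an independent set Z, the
   A_t-image of h(J) h(J') is the square of the sum of h. To make this square equal N minus the sum
   of phi over Z, h has to sum to its root, and the root exists because N bounds the packings. The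
   same summation identity makes the random periodic packing feasible: at each fixed translate, A_t
   K summed over finite sets of packing points is a quadratic form of K with unit weights, and the
   compact support of K confines it to a finite window that serves all translates in a cell. The 2
   in the period 2^k + 2 keeps neighbouring copies of the cube apart.

   Kernels have to be continuous, so phi is a ramp instead of the indicator of the cube, and the
   bound is reached as the width of the ramp tends to 0. Much of the work is topological: openness
   and continuity on independent sets are tested on matrices with separated rows. Separation is a
   closed condition, which yields the compactness behind the support of the kernel and the Radon
   property of the periodic measure. *)
Require Import Defs.
From HB Require Import structures.
From mathcomp Require Import all_boot all_order all_algebra fingroup perm finmap.
From mathcomp Require Import all_classical all_reals all_analysis.
From mathcomp Require Import measurable_realfun zify ring lra.
Set Implicit Arguments.
Unset Strict Implicit.
Unset Printing Implicit Defensive.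
Import Defs.
Import Order.TTheory GRing.Theory Num.Theory.
Import numFieldNormedType.Exports.
Local Open Scope classical_set_scope.
Local Open Scope ring_scope.

(** * Borel sets and Lebesgue measure on vectors *)

Section borel_sets.
Variable T : ptopologicalType.

Lemma borel_open (U : set T) : open U -> measurable (U : set (borel T)).
Proof. by move=> oU; apply: (@sub_sigma_algebra T setT (@open T)). Qed.

Lemma borel_closed (U : set T) : closed U -> measurable (U : set (borel T)).
Proof.
by move=> cU; rewrite -(setCK U); apply: measurableC; apply: borel_open; exact: closed_openC.
Qed.

Lemma borel_measurable_fun d (X : measurableType d) (f : X -> T) :
  (forall U : set T, open U -> measurable (f @^-1` U)) ->
  measurable_fun setT (f : X -> borel T).
Proof.
move=> mf; apply: (@measurability _ _ X (borel T) setT f (@open T)) => // _ [U oU <-].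
by rewrite setTI; exact: mf.
Qed.

End borel_sets.

Lemma borel_continuous (T U : ptopologicalType) (f : T -> U) :
  continuous f -> measurable_fun setT (f : borel T -> borel U).
Proof.
move=> cf; apply: borel_measurable_fun => V oV; apply: (@borel_open T).
by apply: open_comp => // x _; exact: cf.
Qed.

Lemma borel_continuous_real (R : realType) (T : ptopologicalType) (f : T -> R) :
  continuous f -> measurable_fun setT (f : borel T -> measurableTypeR R).
Proof.
move=> cf; apply: (measurability _ (RGenOpens.measurableE R)) => _ [_ [a [b ->] <-]].
by rewrite setTI; apply: (@borel_open T); apply: open_comp => // x _; exact: cf.
Qed.

Definition pushm d d' (T1 : measurableType d) (T2 : measurableType d') (R : realType)
    (m : {measure set T1 -> \bar R}) (f : T1 -> T2) (mf : measurable_fun setT f) :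
    {measure set T2 -> \bar R}.
Proof. by refine ([the {measure set T2 -> \bar R} of pushforward m f]). Defined.

Section sigma_finite_measure_of.
Context d (T : measurableType d) (R : realType) (m : {measure set T -> \bar R}).

(** An alias of [m] that mentions the proof of sigma-finiteness, so that the corresponding structure
    can be attached to a measure for which it is only a proposition. *)
Definition sfinm (_ : sigma_finite setT m) : set T -> \bar R := m.

Variable sm : sigma_finite setT m.
HB.instance Definition _ := Measure.copy (sfinm sm) m.
HB.instance Definition _ := Measure_isSigmaFinite.Build _ _ _ (sfinm sm) sm.

End sigma_finite_measure_of.

Section closed_boxes.
Variables (R : realType) (m n : nat).

(** The closed sup-norm ball, written entrywise so that it decomposes along [row_mx] and is visibly
    a product of intervals. *)
Definition cbox (q : 'M[R]_(m, n)) (r : R) : set 'M[R]_(m, n) :=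
  [set y | forall i j, `|q i j - y i j| <= r].

Lemma cbox_closed q r : closed (cbox q r).
Proof.
have -> : cbox q r = \bigcap_(ij in [set: 'I_m * 'I_n])
    ((fun y : 'M[R]_(m, n) => `|q ij.1 ij.2 - y ij.1 ij.2|) @^-1` [set x | x <= r]).
  apply/seteqP; split=> [y yq [i j] _ /=|y yq i j]; first exact: yq.
  exact: (yq (i, j)).
apply: closed_bigI => -[i j] _; apply: closed_comp => [y _|]; last exact: closed_le.
have C : {for y, continuous (fun y : 'M[R]_(m, n) => q i j - y i j)}.
  by apply: continuousB; [exact: cst_continuous | exact: coord_continuous].
exact: (continuous_comp C (@norm_continuous _ _ _)).
Qed.

Definition qbox (c : 'M[rat]_(m, n) * nat) : set 'M[R]_(m, n) :=
  cbox (map_mx ratr c.1) c.2.+1%:R^-1.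

(** Second countability in a form with closed boxes: the index type is countable, and each box is
    closed and, later, compact. It serves both measurability and sigma-compactness. *)
Lemma open_bigcup_qbox (U : set 'M[R]_(m, n)) : open U ->
  U = \bigcup_(c in [set c | qbox c `<=` U]) qbox c.
Proof.
move=> oU; apply/seteqP; split=> [x Ux|x [c /= cU]]; last exact: cU.
have /nbhs_ballP[e /= e0 eU] : nbhs x U by exact: open_nbhs_nbhs.
have [k ke] : exists k : nat, k.+1%:R^-1 < e / 2.
  have [k _ /(_ k (leqnn _))] := near_infty_natSinv_lt (PosNum (divr_gt0 e0 (ltr0n R 2))).
  by exists k.
have k0 : 0 < k.+1%:R^-1 :> R by rewrite invr_gt0.
have /choice[f fP] : forall ij : 'I_m * 'I_n, exists q : rat,
    `|ratr q - x ij.1 ij.2| <= k.+1%:R^-1.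
  move=> [i j] /=; have [q] := @rat_in_itvoo R (x i j - k.+1%:R^-1) (x i j + k.+1%:R^-1)
    ltac:(by rewrite ltrD2l gtrN).
  by rewrite in_itv /= => q_; exists q; rewrite ltW// ltr_distl.
exists (\matrix_(i, j) f (i, j), k); last first.
  by move=> i j; rewrite !mxE; exact: (fP (i, j)).
move=> y /= qy; apply: eU; split=> // i j; rewrite /ball /=.
have := qy i j; rewrite !mxE; have := fP (i, j) => /= h1 h2.
rewrite distrC in h1.
apply: le_lt_trans (ler_distD (ratr (f (i, j))) _ _) _.
by apply: (le_lt_trans (lerD h1 h2)); rewrite (splitr e) ltrD.
Qed.

End closed_boxes.

(** The source carries the product sigma-algebra and the target the Borel one. The preimage of a
    rational box is a rectangle, and an open set is a countable union of such boxes. *)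
Lemma measurable_row_mx (R : realType) (n : nat) :
  measurable_fun setT (fun z : measurableTypeR R * borel 'rV[R]_n =>
    (row_mx (z.1%:M : 'rV[R]_1) z.2 : borel 'rV[R]_(1 + n))).
Proof.
have e0 : lshift n 0 = 0 :> 'I_(1 + n) by exact: val_inj.
apply: borel_measurable_fun => U oU.
rewrite (open_bigcup_qbox oU) preimage_bigcup bigcup_mkcond.
apply: countable_bigcupT_measurable => // c; case: ifP => // _.
rewrite (_ : _ @^-1` _ = `[ratr (c.1 0 0) - c.2.+1%:R^-1, ratr (c.1 0 0) + c.2.+1%:R^-1] `*`
    cbox (rsubmx (map_mx ratr c.1)) c.2.+1%:R^-1); last first.
  apply/seteqP; split=> -[x y]; rewrite /qbox /cbox /= in_itv/=.
    move=> H; split.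
      by have := H 0 (lshift n 0); rewrite row_mxEl !mxE eqxx mulr1n e0 distrC ler_distl.
    move=> i j; have := H i (rshift 1 j).
    by rewrite row_mxEr !mxE.
  move=> [H1 H2] i j; case: (split_ordP j) => k ->.
    by rewrite row_mxEl !mxE !ord1 eqxx mulr1n e0 distrC ler_distl.
  by have := H2 i k; rewrite row_mxEr !mxE.
apply: measurableX; first exact: measurable_itv.
by apply: borel_closed; exact: cbox_closed.
Qed.

Section lebesgue_rV.
Variable R : realType.
Local Notation mu1 := (@lebesgue_measure R).

Lemma lebesgue_rV0 n : lebesgue_rV (set0 : set 'rV[R]_n) = 0%E.
Proof.
elim: n => [|n IH] /=; first by rewrite indic0.
by apply: integral0_eq => x _; rewrite -[RHS]IH; congr lebesgue_rV.
Qed.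

Lemma lebesgue_rV_cube n (A : set R) : measurable (A : set (measurableTypeR R)) ->
  lebesgue_rV [set x : 'rV[R]_n | forall i, A (x 0 i)] = (mu1 A ^+ n)%E.
Proof.
move=> mA; elim: n => [|n IH].
  by rewrite /= indicE mem_set // => -[].
rewrite expeS -IH /= (_ : mu1 A = \int[mu1]_x (\1_A x)%:E)%E; last first.
  by rewrite integral_indic// setIT.
rewrite -ge0_integralZr//; last first.
- by rewrite IH expe_ge0.
- apply/measurable_EFinP; exact: measurable_indic.
apply: eq_integral => x _; rewrite indicE.
have rl (y : 'rV[R]_n) : row_mx (x%:M : 'rV[R]_1) y 0 (lshift n 0) = x.
  by rewrite row_mxEl !mxE eqxx mulr1n.
have [/set_mem Ax|/negP nAx] := boolP (x \in A).
  rewrite mul1e; congr lebesgue_rV; apply/seteqP; split=> y /= H i.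
    by rewrite -(row_mxEr (x%:M : 'rV[R]_1) y); exact: H.
  case: (@split_ordP 1 n i) => j ->; first by rewrite ord1 rl.
  by move: (H j); rewrite -(row_mxEr (x%:M : 'rV[R]_1) y).
rewrite mul0e -[RHS](lebesgue_rV0 n); congr lebesgue_rV; apply/seteqP; split=> y //= H.
by apply: nAx; rewrite inE -(rl y); exact: H.
Qed.

Lemma ler_mx_norm_entry (m n : nat) (x : 'M[R]_(m, n)) i j : `|x i j| <= `|x|.
Proof.
rewrite -[leRHS]/(mx_norm x) mx_normrE.
by apply/bigmax_geP; right => /=; exists (i, j).
Qed.

Lemma measurable_cube n (A : set R) : measurable (A : set (measurableTypeR R)) ->
  @measurable _ (borel 'rV[R]_n) [set x : 'rV[R]_n | forall i, A (x 0 i)].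
Proof.
move=> mA.
rewrite (_ : [set _ | _] = \bigcap_(i in [set: 'I_n]) ((fun x : 'rV[R]_n => x 0 i) @^-1` A)).
  apply: fin_bigcap_measurable => // i _; rewrite -[X in measurable X]setTI.
  have : measurable_fun setT ((fun x => x 0 i) : borel 'rV[R]_n -> measurableTypeR R).
    by apply: (@borel_continuous_real R 'rV[R]_n) => x; exact: coord_continuous.
  exact.
by apply/seteqP; split=> [x H i _|x H i]; exact: H.
Qed.

(** The recursion defining [lebesgue_rV] is the pushforward of a product measure under [row_mx].
    Sigma-finiteness is carried through the induction because the product measure at the next
    dimension requires it. *)
Lemma lebesgue_rV_measure n :
  {m : {sigma_finite_measure set (borel 'rV[R]_n) -> \bar R} |
    @lebesgue_rV R n = m}.
Proof.
elim: n => [|n [m IH]].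
  by exists (dirac (0 : borel 'rV[R]_0)).
pose f := fun z : measurableTypeR R * borel 'rV[R]_n =>
  (row_mx (z.1%:M : 'rV[R]_1) z.2 : borel 'rV[R]_(1 + n)).
have mf : measurable_fun setT f by exact: measurable_row_mx.
have e : @lebesgue_rV R n.+1 = pushforward (mu1 \x m)%E f.
  apply/funext => A; rewrite /pushforward /product_measure1 /=.
  apply: eq_integral => x _ /=; rewrite IH; congr (m _).
  by apply/seteqP; split=> y; rewrite /xsection /= inE.
pose M : {measure set (borel 'rV[R]_n.+1) -> \bar R} :=
  pushm [the {measure set _ -> \bar R} of (mu1 \x m)%E] mf.
have sM : sigma_finite setT M.
  exists (fun k => [set x : 'rV[R]_n.+1 | forall i, `[- k%:R, k%:R]%classic (x 0 i)]).
    apply/seteqP; split=> // x _.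
    exists (Num.bound `|x|) => // i /=; rewrite in_itv /= -ler_norml.
    by apply: le_trans (ltW (archi_boundP _)) => //; exact: ler_mx_norm_entry.
  move=> k; split; first by apply: measurable_cube; exact: measurable_itv.
  change (M ?x) with (pushforward (mu1 \x m)%E f x); rewrite -e.
  rewrite lebesgue_rV_cube// ltey_eq fin_numX//.
  by rewrite lebesgue_measure_itv /=; case: ifP.
by exists [the {sigma_finite_measure set (borel 'rV[R]_n.+1) -> \bar R} of sfinm sM].
Qed.

Definition lebm n : {sigma_finite_measure set (borel 'rV[R]_n) -> \bar R} :=
  sval (lebesgue_rV_measure n).

Lemma lebmE n : @lebesgue_rV R n = lebm n.
Proof. exact: (svalP (lebesgue_rV_measure n)). Qed.

(** Lebesgue measure is determined by its values on half-open intervals, and translation preserves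
    their lengths. *)
Lemma lebesgue_measure_shift (a : R) (A : set (measurableTypeR R)) : measurable A ->
  pushforward mu1 ((fun x => x + a) : _ -> measurableTypeR R) A = mu1 A.
Proof.
have mf : measurable_fun setT ((fun x => x + a) : measurableTypeR R -> measurableTypeR R).
  by apply: measurable_funD => //; exact: measurable_cst.
move=> mA; apply/esym; apply: (@lebesgue_measure_unique _ (pushm mu1 mf)) => //= _ [[c b]] _ <-.
rewrite /pushforward /= (_ : _ @^-1` _ = `]c - a, b - a]%classic); last first.
  by apply/seteqP; split=> x /=; rewrite !in_itv /= ltrBlDr lerBrDr.
rewrite !lebesgue_measure_itv/= !lte_fin ltrD2r.
by case: ifP => // _; rewrite -!EFinB; congr EFin; ring.
Qed.

(** Split v into its first coordinate [a] and its tail [w]: the induction hypothesis absorbs [w] in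
    every slice, and one-dimensional invariance absorbs [a] in the outer integral. *)
Lemma lebm_shift n (v : 'rV[R]_n) (A : set (borel 'rV[R]_n)) : measurable A ->
  lebm n [set x : 'rV[R]_n | A (x + v)] = lebm n A.
Proof.
elim: n v A => [|n IH] v A mA.
  congr (lebm 0 _).
  by apply/seteqP; split=> x /=; rewrite (_ : x + v = x)//; apply/matrixP => i [].
rewrite -lebmE /=.
pose B := (fun z : measurableTypeR R * borel 'rV[R]_n =>
  (row_mx (z.1%:M : 'rV[R]_1) z.2 : borel 'rV[R]_(1 + n))) @^-1` A.
have mB : measurable B.
  by rewrite -[B]setTI; exact: (@measurable_row_mx R n).
pose a : R := lsubmx (v : 'rV[R]_(1 + n)) 0 0; pose w := rsubmx (v : 'rV[R]_(1 + n)).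
pose g x := lebm n (xsection B x).
have mg : measurable_fun setT g by exact: measurable_fun_xsection.
have gE x : g x = lebesgue_rV [set y : 'rV[R]_n | A (row_mx (x%:M : 'rV[R]_1) y : 'rV[R]_(1 + n))].
  by rewrite lebmE; congr (lebm n _); apply/seteqP; split=> y; rewrite /xsection /= inE.
have E x (y : 'rV[R]_n) : row_mx (x%:M : 'rV[R]_1) y + (v : 'rV[R]_(1 + n)) =
    row_mx (x + a)%:M (y + w).
  by rewrite -[v in LHS](@hsubmxK _ 1 1 n) add_row_mx raddfD /= [lsubmx _]mx11_scalar.
transitivity (\int[mu1]_x g (x + a)%R)%E.
  apply: eq_integral => x _; rewrite /g -(IH w); last exact: measurable_xsection.
  rewrite lebmE; congr (lebm n _); apply/seteqP; split=> y; rewrite /xsection /= inE /B /= => H.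
    exact: (eq_ind _ A H _ (E x y)).
  exact: (eq_ind_r A H (E x y)).
have mf : measurable_fun setT ((fun x => x + a) : measurableTypeR R -> measurableTypeR R).
  by apply: measurable_funD => //; exact: measurable_cst.
transitivity (\int[pushm mu1 mf]_x g x)%E.
  by rewrite (ge0_integral_pushforward mf) // => x _; exact: measure_ge0.
transitivity (\int[mu1]_x g x)%E; last by apply: eq_integral => x _; rewrite gE.
by apply: eq_measure_integral => C mC _; exact: lebesgue_measure_shift.
Qed.

End lebesgue_rV.

(** * The topology of independent sets *)

Lemma continuous_sumr (R : realType) (T : topologicalType) (I : Type) (r : seq I)
    (P : pred I) (F : I -> T -> R) :
  (forall i, P i -> continuous (F i)) -> continuous (fun x => \sum_(i <- r | P i) F i x).
Proof.
move=> cF; elim: r => [|i r IH].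
  rewrite (_ : (fun _ => _) = cst 0); first exact: cst_continuous.
  by apply/funext => y; rewrite big_nil.
have [Pi|Pi] := boolP (P i); last first.
  by under eq_fun do rewrite big_cons (negPf Pi).
rewrite (_ : (fun _ => _) = F i \+ (fun x => \sum_(i <- r | P i) F i x)).
  by move=> x; apply: continuousD; [exact: cF | exact: IH].
by apply/funext => y; rewrite big_cons Pi.
Qed.

Lemma continuous_sqrt_comp (R : realType) (T : topologicalType) (f : T -> R) :
  continuous f -> continuous (fun x => Num.sqrt (f x)).
Proof. by move=> cf x; apply: continuous_comp; [exact: cf | exact: sqrt_continuous]. Qed.

Section edist_theory.
Variables (R : realType) (n : nat).
Implicit Types x y : 'rV[R]_n.

Lemma edist0 x : edist x x = 0.
Proof.
by rewrite /edist big1 ?sqrtr0 // => i _; rewrite subrr expr0n.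
Qed.

Lemma edist_gt0 x y : (0 < edist x y) = (x != y).
Proof.
apply/idP/idP => [|xy]; first by apply: contraTneq => ->; rewrite edist0 ltxx.
rewrite /edist sqrtr_gt0 lt0r sumr_ge0 ?andbT => [|i _]; last exact: sqr_ge0.
apply: contra_neq xy => /eqP; rewrite psumr_eq0 => [|i _]; last exact: sqr_ge0.
move=> /allP H; apply/rowP => i; apply/eqP; rewrite -subr_eq0 -sqrf_eq0.
by apply: (H i); rewrite mem_index_enum.
Qed.

Lemma edist_ge_coord (x y : 'rV[R]_n) i : `|x 0 i - y 0 i| <= edist x y.
Proof.
rewrite -sqrtr_sqr ler_sqrt; last by apply: sumr_ge0 => j _; exact: sqr_ge0.
by rewrite (bigD1 i) //= lerDl; apply: sumr_ge0 => j _; exact: sqr_ge0.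
Qed.

Lemma continuous_edist_rows k (i j : 'I_k) :
  continuous (fun v : 'M[R]_(k, n) => edist (row i v) (row j v)).
Proof.
apply: continuous_sqrt_comp; apply: continuous_sumr => l _ v.
rewrite (_ : (fun _ => _) = (fun v : 'M[R]_(k, n) => (v i l - v j l) * (v i l - v j l))).
  have C : {for v, continuous (fun v : 'M[R]_(k, n) => v i l - v j l)}.
    by apply: continuousB; exact: coord_continuous.
  exact: (continuousM C C).
by apply/funext => w; rewrite !mxE.
Qed.

End edist_theory.

Section separated_matrices.
Variables (R : realType) (n k : nat).
Implicit Types v w : 'M[R]_(k, n).

Definition rowset v : {fset 'rV[R]_n} := [fset row i v | i in 'I_k]%fset.

Definition sepmx : set 'M[R]_(k, n) :=
  [set v | forall i j, i != j -> 2 <= edist (row i v) (row j v)].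

(** The open companion of the closed condition [sepmx]. Distinctness of rows is what makes matrices
    with equal row sets differ by a permutation, and its openness is used when sets are pulled back
    to all matrices. *)
Definition injmx : set 'M[R]_(k, n) :=
  [set v | forall i j, i != j -> 0 < edist (row i v) (row j v)].

Lemma sepmx_inj : sepmx `<=` injmx.
Proof. by move=> v sv i j ij; apply: lt_le_trans (sv i j ij). Qed.

Lemma injmxP v : injmx v <-> injective (fun i => row i v).
Proof.
split=> [iv i j e|iv i j ij].
  by apply/eqP/negPn/negP => ij; have := iv i j ij; rewrite e edist0 ltxx.
by rewrite edist_gt0; apply: contra_neq ij => /iv.
Qed.

Lemma sepmx_closed : closed sepmx.
Proof.
have -> : sepmx = \bigcap_(ij in [set ij : 'I_k * 'I_k | ij.1 != ij.2])
    ((fun v : 'M[R]_(k, n) => edist (row ij.1 v) (row ij.2 v)) @^-1` [set x | 2 <= x]).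
  by apply/seteqP; split=> [v sv [i j] /= ij|v sv i j ij]; [exact: sv | exact: (sv (i, j))].
apply: closed_bigI => -[i j] _; apply: closed_comp => [v _|]; last exact: closed_ge.
exact: continuous_edist_rows.
Qed.

Lemma injmx_open : open injmx.
Proof.
have oinj (r : seq ('I_k * 'I_k)) : open [set v : 'M[R]_(k, n) |
    all (fun ij => (ij.1 != ij.2) ==> (0 < edist (row ij.1 v) (row ij.2 v))) r].
  elim: r => [|[i j] r IH]; first by rewrite (_ : mkset _ = setT); [exact: openT | apply/seteqP].
  rewrite (_ : mkset _ = [set v | (i != j) ==> (0 < edist (row i v) (row j v))] `&`
    [set v | all (fun ij => (ij.1 != ij.2) ==> (0 < edist (row ij.1 v) (row ij.2 v))) r]); last first.
    by apply/seteqP; split=> v /= => [/andP[]|[-> ->]].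
  apply: openI => //; case: eqVneq => _ /=.
    by rewrite (_ : mkset _ = setT); [exact: openT | apply/seteqP].
  apply: (@open_comp _ _ (fun v : 'M[R]_(k, n) => edist (row i v) (row j v)) [set x | 0 < x]).
    by move=> v _; exact: continuous_edist_rows.
  exact: open_gt.
rewrite (_ : injmx = [set v | all (fun ij => (ij.1 != ij.2) ==>
  (0 < edist (row ij.1 v) (row ij.2 v))) (enum {: 'I_k * 'I_k})]); first exact: oinj.
apply/seteqP; split=> v /= => [iv|/allP iv i j ij].
  by apply/allP => -[i j] _; apply/implyP; exact: iv.
by have := iv (i, j); rewrite mem_enum /= ij; exact.
Qed.

Lemma mem_rowset v x : (x \in rowset v) = [exists i, x == row i v].
Proof.
apply/imfsetP/existsP => [[i _ ->]|[i /eqP ->]]; first by exists i.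
by exists i.
Qed.

Lemma row_rowset v i : row i v \in rowset v.
Proof. by rewrite mem_rowset; apply/existsP; exists i. Qed.

Lemma card_rowset v : (#|` rowset v| == k) = `[< injmx v >].
Proof.
apply/eqP/asboolP => [|/injmxP iv]; last first.
  by rewrite card_imfset //= -[RHS]card_ord cardE.
rewrite /rowset => e; apply/injmxP => i j /eqP; apply: contraTeq => ij.
apply/eqP => eij; move: e; apply/eqP; rewrite neq_ltn; apply/orP; left.
(* If rows i and j coincide, omitting i leaves the row set unchanged, so it has at most k - 1
   elements. *)
rewrite (_ : imfset _ _ _ = [fset row a v | a in [pred a | a != i]]%fset); last first.
  apply/fsetP => x; apply/imfsetP/imfsetP => [[a _ ->]|[a _ ->]]; last by exists a.
  have [->|ai] := eqVneq a i; last by exists a.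
  by rewrite eq_sym in ij; exists j.
apply: leq_ltn_trans (leq_imfset_card _ _ _) _; rewrite -cardE.
have := cardC (pred1 i); rewrite card1 card_ord => e.
by rewrite -[X in (_ < X)%N]e add1n ltnS; apply/eq_leq/eq_card => a; rewrite !inE.
Qed.

Lemma rowset_perm v w : injmx v -> injmx w -> rowset v = rowset w ->
  exists s : 'S_k, w = row_perm s v.
Proof.
move=> /injmxP iv /injmxP iw e.
have /choice[f fP] : forall i, exists j, row i w = row j v.
  by move=> i; have := row_rowset w i; rewrite -e mem_rowset => /existsP[j /eqP ->]; exists j.
have fi : injective f by move=> i j fij; apply: iw; rewrite !fP fij.
exists (perm fi); apply/row_matrixP => i; rewrite fP; apply/rowP => l.
by rewrite !mxE permE.
Qed.

Lemma rowset_row_perm v (s : 'S_k) : rowset (row_perm s v) = rowset v.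
Proof.
apply/fsetP => x; rewrite !mem_rowset; apply/existsP/existsP => -[i /eqP ->].
  by exists (s i); apply/eqP/rowP => l; rewrite !mxE.
by exists ((s^-1)%g i); apply/eqP/rowP => l; rewrite !mxE permKV.
Qed.

Lemma sepmx_independent v : sepmx v -> independent (rowset v).
Proof.
move=> sv x y; rewrite !mem_rowset => /existsP[i /eqP->] /existsP[j /eqP->] ij.
by apply: sv; apply: contra_neq ij => ->.
Qed.

Lemma independent_sepmx v : injmx v -> independent (rowset v) -> sepmx v.
Proof.
move=> /injmxP iv ind i j ij; apply: ind; rewrite ?row_rowset //.
by apply: contra_neq ij => /iv.
Qed.

Lemma fset_rowset (S : {fset 'rV[R]_n}) : #|` S| = k ->
  exists2 v, injmx v & rowset v = S.
Proof.
move=> Sk; pose v := \matrix_(i < k) nth 0 S i.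
have vS : rowset v = S.
  apply/fsetP => x; rewrite mem_rowset; apply/existsP/idP => [[i /eqP ->]|xS].
    by rewrite rowK mem_nth // Sk.
  have xk : (index x S < k)%N by rewrite -Sk index_mem.
  by exists (Ordinal xk); rewrite rowK /= nth_index.
by exists v => //; apply/asboolP; rewrite -card_rowset vS Sk.
Qed.

End separated_matrices.

Section indepset_topology.
Variables (R : realType) (n t : nat).
Local Notation I := (indepset R n t).

(** A total map: a set that is not independent or has more than t points goes to the empty set.
    [toindepK] gives its value on the intended sets. *)
Definition toindep (S : {fset 'rV[R]_n}) : I := insubd (indepset0 R n t) S.

Lemma toindepK (S : {fset 'rV[R]_n}) : independent S -> (#|` S| <= t)%N ->
  toindep S = S :> {fset 'rV[R]_n}.
Proof. by move=> iS St; rewrite /toindep -[LHS]/(\val _) val_insubd asboolT //= St. Qed.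

Lemma indepset_independent (S : I) : independent S.
Proof. by case: S => S /= /andP[/asboolP]. Qed.

Lemma indepset_card (S : I) : (#|` S| <= t)%N.
Proof. by case: S => S /= /andP[]. Qed.

Lemma toindep_val (S : I) : toindep S = S.
Proof. by apply: val_inj; exact: toindepK (@indepset_independent S) (@indepset_card S). Qed.

Definition rowi k (v : 'M[R]_(k, n)) : I := toindep (rowset v).

Lemma card_sepmx k (v : 'M[R]_(k, n)) : sepmx v -> #|` rowset v| = k.
Proof. by move=> /sepmx_inj iv; apply/eqP; rewrite card_rowset; apply/asboolP. Qed.

Lemma rowiE k (v : 'M[R]_(k, n)) : (k <= t)%N -> sepmx v -> rowi v = rowset v :> {fset _}.
Proof. by move=> kt sv; rewrite toindepK ?card_sepmx //; exact: sepmx_independent. Qed.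

Lemma indepset_rowi (S : I) k : #|` S| = k ->
  exists v : 'M[R]_(k, n), [/\ sepmx v, rowi v = S & rowset v = S].
Proof.
move=> Sk; have [v iv vS] := fset_rowset Sk.
exists v; split=> //; last by rewrite /rowi vS toindep_val.
by apply: independent_sepmx => //; rewrite vS; exact: indepset_independent.
Qed.

(** On the stratum of size k, [rowi] presents the topology as a quotient of the separated matrices,
    so openness becomes a trace condition on matrices. *)
Lemma indepset_openP (U : set I) : open U <->
  forall k, (k <= t)%N -> exists2 W : set 'M[R]_(k, n), open W &
    forall v, sepmx v -> (U (rowi v) <-> W v).
Proof.
have -> : open U = indepset_open U by [].
split=> [oU k kt|H k].
  have [V [oV UV]] := oU k; exists [set v : 'M[R]_(k, n) | V (rowset v)] => // v sv /=.
  by rewrite UV rowiE// card_sepmx.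
have [kt|tk] := leqP k t; last first.
  exists set0; split; first by rewrite /quotient_fset_open /=; exact: open0.
  by move=> S Sk; have := indepset_card S; rewrite Sk leqNgt tk.
have [W oW UW] := H k kt.
(* W need not be symmetric under permutations of rows. The sets with some representative in W pull
   back to the union of all row permutations of W, cut with [injmx], and this is open. *)
exists [set X | #|` X| = k /\ exists2 w : 'M[R]_(k, n), rowset w = X & W w].
split; last first.
  move=> S Sk; have [v [sv vS _]] := indepset_rowi Sk.
  split=> [US|[_ [w wS Ww]]].
    by split=> //; exists v; [rewrite -vS rowiE | apply: (UW v sv).1; rewrite vS].
  have iw : injmx w by apply/asboolP; rewrite -card_rowset wS Sk.
  have sw : sepmx w by apply: independent_sepmx => //; rewrite wS; exact: indepset_independent.
  suff -> : S = rowi w by apply/UW.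
  by rewrite /rowi wS toindep_val.
rewrite /quotient_fset_open.
rewrite (_ : mkset _ = @injmx R n k `&` \bigcup_(s in [set: 'S_k]) (row_perm s @^-1` W)).
  apply: openI; first exact: injmx_open.
  apply: bigcup_open => s _; apply: open_comp => // v _.
  move=> B [/= P Pn PB]; exists (fun i j => P ((s^-1)%g i) j) => [i j|w Pw].
    by have := Pn ((s^-1)%g i) j; rewrite mxE permKV.
  by apply: PB => i j; rewrite mxE; have := Pw (s i) j; rewrite permK.
apply/seteqP; split=> v /=.
  move=> [vk [w wv Ww]]; have iv : injmx v by apply/asboolP; rewrite -card_rowset; apply/eqP.
  split=> //; have [|s ws] := rowset_perm iv _ (esym wv).
    by apply/asboolP; rewrite -card_rowset wv; apply/eqP.
  by exists s => //=; rewrite -ws.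
move=> [iv [s _ /= Ws]]; split; first by apply/eqP; rewrite card_rowset; apply/asboolP.
by exists (row_perm s v) => //; rewrite rowset_row_perm.
Qed.

Lemma rowi_continuous k : (k <= t)%N -> {within @sepmx R n k, continuous (@rowi k)}.
Proof.
move=> kt; apply/continuousP => U /indepset_openP/(_ k kt)[W oW UW].
apply/open_subspaceP; exists W => //.
by apply/seteqP; split=> v [h sv]; split=> //; apply/UW.
Qed.

(** The universal property of the quotient and of the disjoint union: continuity is checked on
    matrices, one cardinality at a time. *)
Lemma indepset_continuousP (T : topologicalType) (f : I -> T) :
  (forall k, (k <= t)%N -> {within @sepmx R n k, continuous (f \o @rowi k)}) ->
  continuous f.
Proof.
move=> cf; apply/continuousP => U oU; apply/indepset_openP => k kt.
have /continuousP/(_ _ oU)/open_subspaceP[W oW e] := cf k kt.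
exists W => // v sv.
have /= := congr1 (fun A : set _ => A v) e; rewrite /setI /= => ev.
split=> h; first by have [] : W v /\ sepmx v by rewrite ev.
by have [] : U (f (rowi v)) /\ sepmx v by rewrite -ev.
Qed.

End indepset_topology.

(** * Moebius inversion and the operator A_t *)

Section mobius.
Variables (R : comNzRingType) (s : R -> R).

(* The Moebius inverse at J of S |-> s (\sum_(x <- S) phi x), as a function of
   the values of phi on J only, is [mob [seq phi x | x <- J] 0]; the recursion
   unfolds one inclusion-exclusion step per point.  Zero values of phi do not
   contribute, which is what makes it continuous and compactly supported. *)
Fixpoint mob (l : seq R) (a : R) : R :=
  if l is x :: l' then mob l' (a + x) - mob l' a else s a.

Lemma mob_swap x y l a : mob [:: x, y & l] a = mob [:: y, x & l] a.
Proof. by rewrite /= (addrAC a); ring. Qed.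

Lemma mob_cons_congr x l l' : (forall a, mob l a = mob l' a) ->
  forall a, mob (x :: l) a = mob (x :: l') a.
Proof. by move=> e a /=; rewrite !e. Qed.

Lemma mob_rcons_front l1 x l2 a : mob (l1 ++ x :: l2) a = mob (x :: l1 ++ l2) a.
Proof.
elim: l1 a => // y l1 IH a.
by rewrite cat_cons (mob_cons_congr _ IH) mob_swap.
Qed.

(** A finite set lists its points in an arbitrary order, so [mob] describes a function of the set
    only through this symmetry. *)
Lemma mob_perm l l' a : perm_eq l l' -> mob l a = mob l' a.
Proof.
elim: l l' a => [|x l IH] l' a.
  by rewrite perm_sym => /perm_nilP ->.
move=> p; have xl' : x \in l' by rewrite -(perm_mem p) mem_head.
case/splitPr: xl' p => l1 l2 p.
rewrite mob_rcons_front; apply: mob_cons_congr => b; apply: IH.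
have : perm_eq (l1 ++ x :: l2) (x :: l1 ++ l2) by rewrite (perm_catCA l1 [:: x] l2).
by move=> /(perm_trans p); rewrite perm_cons.
Qed.

Lemma mob_eq0 l a : 0 \in l -> mob l a = 0.
Proof.
elim: l a => // x l IH a; rewrite inE => /orP[/eqP <-|xl] /=.
  by rewrite addr0 subrr.
by rewrite !IH ?subrr.
Qed.

End mobius.

Section fpowerset_sums.
Variables (K : choiceType) (V : nmodType).
Local Open Scope fset_scope.

Lemma big_fpowersetU1 (x : K) (S : {fset K}) (F : {fset K} -> V) : x \notin S ->
  (\sum_(J <- fpowerset (x |` S)) F J =
   \sum_(J <- fpowerset S) F J + \sum_(J <- fpowerset S) F (x |` J))%R.
Proof.
move=> xS.
have xJ J : J \in fpowerset S -> x \notin J.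
  by rewrite fpowersetE => /fsubsetP JS; apply: contra xS; exact: JS.
rewrite -[X in (_ + X)%R](big_map (fun J => x |` J) predT F) -big_cat /=.
apply: perm_big; apply: uniq_perm; first exact: fset_uniq.
  rewrite cat_uniq fset_uniq map_inj_in_uniq ?fset_uniq ?andbT /=.
    apply/hasPn => _ /mapP[J JS ->]; apply/negP => /xJ.
    by rewrite !inE eqxx.
  move=> J J' /xJ h /xJ h' e; apply/fsetP => y.
  have := congr1 (fun A : {fset K} => y \in A) e; rewrite !inE.
  by have [->|//] := eqVneq y x; rewrite (negPf h) (negPf h').
move=> J; rewrite mem_cat fpowersetE.
apply/idP/orP => [JS|[|/mapP[J' + ->]]].
- have [xinJ|xnJ] := boolP (x \in J); [right|left].
    apply/mapP; exists (J `\ x); last by rewrite fsetD1K.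
    rewrite fpowersetE; apply/fsubsetP => y; rewrite !inE => /andP[yx yJ].
    by have := fsubsetP JS y yJ; rewrite !inE (negPf yx).
  rewrite fpowersetE; apply/fsubsetP => y yJ.
  have := fsubsetP JS y yJ; rewrite !inE => /orP[/eqP e|//].
  by rewrite e (negPf xnJ) in yJ.
- by rewrite fpowersetE => /fsubset_trans; apply; exact: fsubsetUr.
- by rewrite fpowersetE => h; apply: fsetUS.
Qed.

End fpowerset_sums.

(** Moebius inversion by removing one point x: pairing J with J plus x telescopes the recursion of
    [mob] and moves [phi x] into the accumulator. Hence the statement is for every [a]. *)
Lemma sum_mob_fpowerset (K : choiceType) (R : comNzRingType) (s : R -> R) (phi : K -> R)
    (S : {fset K}) (a : R) :
  \sum_(J <- fpowerset S) mob s [seq phi x | x <- J] a = s (a + \sum_(x <- S) phi x).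
Proof.
elim/finSet_rect: S a => S IH a.
have [->|[x xS]] := fset_0Vmem S.
  by rewrite fpowerset0 !big_seq_fset1 /= big_seq_fset0 addr0.
have xS' : x \notin (S `\ x)%fset by rewrite !inE eqxx.
rewrite -(fsetD1K xS) big_fpowersetU1 // big_fsetU1 //= addrA -IH ?fproperD1 //.
rewrite -big_split /=.
rewrite big_seq [RHS]big_seq; apply: eq_bigr => J; rewrite fpowersetE => /fsubsetP JS.
have xJ : x \notin J by apply/negP => /JS; rewrite (negPf xS').
rewrite (@mob_perm _ s [seq phi y | y <- (x |` J)%fset] (phi x :: [seq phi y | y <- J])) /=.
  by rewrite addrC subrK.
rewrite -map_cons; apply: perm_map; apply: uniq_perm; rewrite /= ?xJ ?fset_uniq //.
by move=> y; rewrite !inE.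
Qed.


Section A_op_sums.
Variables (R : realType) (n t : nat).
Implicit Types (f : indepset R n t * indepset R n t -> R) (S Z : {fset 'rV[R]_n}).

Lemma independent_sub S Z : (S `<=` Z)%fset -> independent Z -> independent S.
Proof. by move=> /fsubsetP SZ iZ x y xS yS; apply: iZ; exact: SZ. Qed.

(* Summing over an ambient independent set Z rather than over subsets of S
   lets the order of summation be exchanged in [A_op_sum]. *)
Lemma A_opE f (S : indepset R n (2 * t)) Z : independent Z -> (S `<=` Z)%fset ->
  A_op f S = \sum_(J <- fpowerset Z | (#|` J| <= t)%N)
    \sum_(J' <- fpowerset Z | (#|` J'| <= t)%N && ((J `|` J')%fset == S))
      f (toindep t J, toindep t J').
Proof.
move=> iZ SZ; rewrite /A_op.
pose r0 : seq {fset 'rV[R]_n} := [seq J <- fpowerset Z | (#|` J| <= t)%N].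
have r0E (J : {fset 'rV[R]_n}) : J \in r0 -> toindep t J = J :> {fset _}.
  rewrite mem_filter fpowersetE => /andP[Jt JZ].
  by rewrite toindepK //; exact: independent_sub iZ.
have ur0 : uniq [seq toindep t J | J <- r0].
  rewrite map_inj_in_uniq ?filter_uniq ?fset_uniq // => J J' /r0E e /r0E e' h.
  by rewrite -e -e' h.
pose r := [seq p : indepset R n t * indepset R n t <- [seq (x, y) | x <- [seq toindep t J | J <- r0],
   y <- [seq toindep t J | J <- r0]] | (p.1 `|` p.2)%fset == S :> {fset _}].
have inr0 (J : indepset R n t) : (J `<=` S)%fset -> J \in [seq toindep t J | J <- r0].
  move=> JS; apply/mapP; exists (J : {fset _}); last by rewrite toindep_val.
  by rewrite mem_filter indepset_card fpowersetE /=; exact: fsubset_trans SZ.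
rewrite (_ : [set p | _] = [set` r]); last first.
  apply/seteqP; split=> [[J J']|[J J']] /=; last first.
    by rewrite mem_filter => /andP[/eqP].
  move=> e; rewrite mem_filter /= e eqxx; apply/allpairsP; exists (J, J').
  by split=> //=; apply: inr0; rewrite -e ?fsubsetUl ?fsubsetUr.
rewrite -fsbig_seq; last first.
  by apply: filter_uniq; apply: allpairs_uniq => // -[a b] [a' b'] _ _ [-> ->].
rewrite big_filter big_mkcond big_allpairs_dep big_map -[RHS]big_filter -/r0.
rewrite big_seq [RHS]big_seq; apply: eq_bigr => J Jr.
rewrite big_map -[RHS]big_filter_cond -/r0 [RHS]big_mkcond big_seq [RHS]big_seq.
by apply: eq_bigr => J' Jr' /=; rewrite !r0E.
Qed.

(** Each pair of subsets of Z with at most t points contributes to exactly one S, its union, which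
    has at most 2t points. The double sum is a square for a rank-one kernel and nonnegative for a
    positive semidefinite one, which serves the two bounds respectively. *)
Lemma A_op_sum f Z : independent Z ->
  \sum_(S <- fpowerset Z | (#|` S| <= 2 * t)%N) A_op f (toindep (2 * t) S) =
  \sum_(J <- fpowerset Z | (#|` J| <= t)%N) \sum_(J' <- fpowerset Z | (#|` J'| <= t)%N)
    f (toindep t J, toindep t J').
Proof.
move=> iZ.
transitivity (\sum_(S <- fpowerset Z | (#|` S| <= 2 * t)%N)
   \sum_(J <- fpowerset Z | (#|` J| <= t)%N)
    \sum_(J' <- fpowerset Z | (#|` J'| <= t)%N && ((J `|` J')%fset == S))
      f (toindep t J, toindep t J')).
  rewrite big_seq_cond [RHS]big_seq_cond; apply: eq_bigr => S /andP[].
  rewrite fpowersetE => SZ St.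
  have SE := toindepK (independent_sub SZ iZ) St.
  rewrite (A_opE f iZ) SE //.
rewrite exchange_big big_seq_cond [RHS]big_seq_cond; apply: eq_bigr => J /andP[JZ Jt] /=.
under eq_bigr do rewrite big_mkcondr /=.
rewrite exchange_big /= big_seq_cond [RHS]big_seq_cond; apply: eq_bigr => J' /andP[J'Z J't].
rewrite !fpowersetE in JZ J'Z.
have JJ't : (#|` (J `|` J')%fset| <= 2 * t)%N.
  by rewrite cardfsU mul2n -addnn (leq_trans (leq_subr _ _)) // leq_add.
rewrite big_mkcond (bigD1_seq (J `|` J')%fset) ?fset_uniq ?fpowersetE ?fsubUset ?JZ //=.
rewrite JJ't eqxx big1 ?addr0 // => T /negPf TJ.
by rewrite (eq_sym (J `|` J')%fset) TJ; case: ifP.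
Qed.

End A_op_sums.

(** * Continuous functions and compact sets of independent sets *)

Section continuous_realfun.
Variables (R : realType) (T : topologicalType) (f g : T -> R).
Hypotheses (cf : continuous f) (cg : continuous g).

Lemma contD : continuous (fun x => f x + g x).
Proof. by move=> x; apply: continuousD; [exact: cf | exact: cg]. Qed.

Lemma contB : continuous (fun x => f x - g x).
Proof. by move=> x; apply: continuousB; [exact: cf | exact: cg]. Qed.

Lemma contM : continuous (fun x => f x * g x).
Proof. by move=> x; apply: continuousM; [exact: cf | exact: cg]. Qed.

Lemma cont_max : continuous (fun x => Num.max (f x) (g x)).
Proof. by move=> x; apply: continuous_max; [exact: cf | exact: cg]. Qed.

Lemma cont_min : continuous (fun x => Num.min (f x) (g x)).
Proof. by move=> x; apply: continuous_min; [exact: cf | exact: cg]. Qed.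

End continuous_realfun.

Lemma continuous_mx (R : realType) (T : topologicalType) (m n : nat)
    (F : T -> 'M[R]_(m, n)) :
  (forall i j, continuous (fun x => F x i j)) -> continuous F.
Proof.
move=> cF x B [/= P Pn PB].
have : \forall y \near x, forall ij : 'I_m * 'I_n, P ij.1 ij.2 (F y ij.1 ij.2).
  by apply: filter_forall => -[i j]; exact: (cF i j x _ (Pn i j)).
by apply: filterS => y Py; apply: PB => i j; exact: (Py (i, j)).
Qed.

(** Compactness of a product of segments, known for row vectors, is transported along the continuous
    map [vec_mx]. *)
Lemma cbox_compact (R : realType) (m n : nat) (q : 'M[R]_(m, n)) (r : R) :
  compact (cbox q r).
Proof.
have -> : cbox q r = vec_mx @` [set v : 'rV[R]_(m * n) |
    forall k, `[mxvec q 0 k - r, mxvec q 0 k + r]%classic (v 0 k)].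
  apply/seteqP; split=> [y yq|_ [v vq <-] i j].
    exists (mxvec y); last by rewrite mxvecK.
    move=> k; case/mxvec_indexP: k => i j.
    by rewrite /= in_itv /= !mxvecE -ler_distl distrC; exact: yq.
  have := vq (mxvec_index i j).
  by rewrite /= in_itv /= !mxvecE !mxE -ler_distl distrC.
apply: continuous_compact; last first.
  apply: (@rV_compact _ _ (fun k => `[mxvec q 0 k - r, mxvec q 0 k + r]%classic)) => k.
  exact: segment_compact.
apply: continuous_subspaceT; apply: continuous_mx => i j v.
rewrite (_ : (fun _ => _) = (fun v : 'rV[R]_(m * n) => v 0 (mxvec_index i j))).
  exact: coord_continuous.
by apply/funext => w; rewrite mxE.
Qed.

Lemma continuous_mob (R : realType) (T : topologicalType) (I : Type) (r : seq I)
    (s : R -> R) (f : I -> T -> R) : continuous s -> (forall i, continuous (f i)) ->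
  continuous (fun x => mob s [seq f i x | i <- r] 0).
Proof.
move=> cs cf.
suff H a : continuous a -> continuous (fun x => mob s [seq f i x | i <- r] (a x)).
  by apply: H; exact: cst_continuous.
elim: r a => [|i r IH] a ca /=.
  by move=> x; apply: continuous_comp; [exact: ca | exact: cs].
by apply: contB; [apply: IH; exact: contD | exact: IH].
Qed.

Section indepset_functions.
Variables (R : realType) (n t : nat).
Local Notation I := (indepset R n t).

Lemma continuous_row k i : continuous (fun v : 'M[R]_(k, n) => row i v).
Proof.
apply: continuous_mx => a j v.
rewrite (_ : (fun _ => _) = (fun v : 'M[R]_(k, n) => v i j)); first exact: coord_continuous.
by apply/funext => w; rewrite mxE.
Qed.

Lemma perm_rowset k (v : 'M[R]_(k, n)) : injmx v ->
  perm_eq (rowset v) [seq row i v | i <- enum 'I_k].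
Proof.
move=> iv; apply: uniq_perm; first exact: fset_uniq.
  by rewrite map_inj_uniq ?enum_uniq //; apply/injmxP.
move=> x; rewrite mem_rowset; apply/existsP/mapP => [[i /eqP ->]|[i _ ->]]; exists i => //.
by rewrite mem_enum.
Qed.

(** Symmetry of [F] replaces the listing order of the finite set by the order of the rows, in which
    the expression is continuous on each stratum. *)
Lemma continuous_indepset_seq (psi : 'rV[R]_n -> R) (F : seq R -> R) :
  (forall l l', perm_eq l l' -> F l = F l') ->
  (forall k, continuous (fun v : 'M[R]_(k, n) => F [seq psi (row i v) | i <- enum 'I_k])) ->
  continuous (fun S : I => F [seq psi x | x <- (S : {fset _})]).
Proof.
move=> pF cF; apply: indepset_continuousP => k kt.
apply: (@subspace_eq_continuous _ _ _
    (fun v => F [seq psi (row i v) | i <- enum 'I_k])); last first.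
  by apply: continuous_subspaceT; exact: cF.
move=> v /set_mem sv.
rewrite -[RHS]/(F [seq psi x | x <- (@rowi R n t k v : {fset _})]) (@rowiE R n t k v kt sv).
apply: pF; rewrite (map_comp psi) perm_sym; apply: perm_map.
by apply: perm_rowset; exact: sepmx_inj.
Qed.

Lemma continuous_comp_row k i (psi : 'rV[R]_n -> R) : continuous psi ->
  continuous (fun v : 'M[R]_(k, n) => psi (row i v)).
Proof. by move=> c v; apply: continuous_comp; [exact: continuous_row | exact: c]. Qed.

Lemma continuous_indepset_mob (psi : 'rV[R]_n -> R) (s : R -> R) :
  continuous psi -> continuous s ->
  continuous (fun S : I => mob s [seq psi x | x <- (S : {fset _})] 0).
Proof.
move=> cpsi cs; apply: (@continuous_indepset_seq _ (fun l => mob s l 0)).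
  by move=> l l'; exact: mob_perm.
by move=> k; apply: continuous_mob => // i; exact: continuous_comp_row.
Qed.

Lemma continuous_indepset_sum (psi : 'rV[R]_n -> R) : continuous psi ->
  continuous (fun S : I => \sum_(x <- (S : {fset _})) psi x).
Proof.
move=> cpsi; under eq_fun do rewrite -(big_map psi predT id).
apply: (@continuous_indepset_seq _ (fun l => \sum_(x <- l) x)).
  by move=> l l' ll'; exact: perm_big.
move=> k; under eq_fun do rewrite big_map.
by apply: continuous_sumr => i _; exact: continuous_comp_row.
Qed.

(** Points are separated by continuous functions: if x lies in S but not in T, the sum over the
    points y of a set of the product over z in T of |y - z| vanishes at T and is positive at S. *)
Lemma indepset_hausdorff : hausdorff_space I.
Proof.
have sep (S T : I) (x : 'rV[R]_n) : x \in (S : {fset _}) -> x \notin (T : {fset _}) ->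
    exists2 f : I -> R, continuous f & 0 < f S /\ f T = 0.
  move=> xS xT.
  pose psi (r : seq 'rV[R]_n) (z : 'rV[R]_n) : R := \prod_(y <- r) `|z - y|.
  have cpsi r : continuous (psi r).
    elim: r => [|y r IH].
      rewrite (_ : psi _ = cst 1); first exact: cst_continuous.
      by apply/funext => z; rewrite /psi big_nil.
    rewrite (_ : psi _ = (fun z => `|z - y| * psi r z)); last first.
      by apply/funext => z; rewrite /psi big_cons.
    apply: contM => // z; apply: continuous_comp; last exact: norm_continuous.
    by apply: continuousB; [exact: cvg_id | exact: cst_continuous].
  exists (fun S : I => \sum_(y <- (S : {fset _})) psi (T : {fset _}) y).
    exact: continuous_indepset_sum.
  split; last first.
    rewrite big_seq big1 // => y yT; apply/eqP; rewrite /psi prodf_seq_eq0.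
    by apply/hasP; exists y; rewrite //= subrr normr0.
  rewrite (big_fsetD1 x) //= ltr_pwDl //.
    rewrite /psi big_seq prodr_gt0 // => y yT; rewrite normr_gt0 subr_eq0.
    by apply: contraNneq xT => ->.
  by apply: sumr_ge0 => y _; apply: prodr_ge0 => z _; exact: normr_ge0.
have sep2 (S T : I) : S != T -> exists2 f : I -> R, continuous f & f S < f T \/ f T < f S.
  move=> ST; have [x] : exists x, (x \in (S : {fset _})) != (x \in (T : {fset _})).
    apply: contrapT => /forallNP h; move/eqP: ST; apply; apply/val_inj/fsetP => x.
    by apply/eqP/negPn/negP; exact: h.
  have [xS|xS] := boolP (x \in (S : {fset _})); have [xT|xT] := boolP (x \in (T : {fset _})) => // _.
    by have [f cf [f0 fT]] := sep _ _ _ xS xT; exists f => //; right; rewrite fT.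
  by have [f cf [f0 fS]] := sep _ _ _ xT xS; exists f => //; left; rewrite fS.
rewrite open_hausdorff => S T /sep2[f cf fST].
have olt (a : R) : open (f @^-1` [set z | z < a]).
  by apply: open_comp; [move=> z _; exact: cf | exact: open_lt].
have ogt (a : R) : open (f @^-1` [set z | a < z]).
  by apply: open_comp; [move=> z _; exact: cf | exact: open_gt].
have dis (a : R) : (f @^-1` [set z | z < a]) `&` (f @^-1` [set z | a < z]) == set0.
  by apply/eqP/seteqP; split=> z //= [h1 h2]; have := lt_trans h1 h2; rewrite ltxx.
pose a := (f S + f T) / 2.
case: fST => fST.
  exists (f @^-1` [set z | z < a], f @^-1` [set z | a < z]) => //=.
  by rewrite !inE /= /a; split; lra.
exists (f @^-1` [set z | a < z], f @^-1` [set z | z < a]) => /=.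
  by rewrite !inE /= /a; split; lra.
by split=> //; rewrite setIC.
Qed.

(** Points at distance at least 2 cannot merge in a limit: [sepmx] is closed, so each stratum is a
    continuous image of a compact set of matrices, and there are t + 1 strata. *)
Lemma compact_subcube (c : 'rV[R]_n) (r : R) :
  compact [set S : I | forall x, x \in (S : {fset _}) -> cbox c r x].
Proof.
pose A k := cbox (\matrix_(i < k) c) r `&` @sepmx R n k.
rewrite (_ : mkset _ = \big[setU/set0]_(k < t.+1) (@rowi R n t k @` A k)).
  apply: bigsetU_compact => k _; apply: continuous_compact.
    apply: continuous_subspaceW (@rowi_continuous R n t k _); last by rewrite -ltnS.
    by move=> v [].
  by apply: compact_closedI; [exact: cbox_compact | exact: sepmx_closed].
apply/seteqP; split=> [S Sc|S].
  rewrite -(bigcup_mkord t.+1 (fun k => @rowi R n t k @` A k)); exists #|` S|; first by rewrite /= ltnS indepset_card.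
  have [v [sv vS vE]] := indepset_rowi (erefl #|` S|).
  exists v => //; split=> // i j; have := Sc (row i v); rewrite -[X in _ \in X]vE.
  by move=> /(_ (row_rowset v i) 0 j); rewrite !mxE.
rewrite -(bigcup_mkord t.+1 (fun k => @rowi R n t k @` A k)) => -[k kt [v [vc sv] <-]] x.
have kt' : (k <= t)%N by rewrite -ltnS.
rewrite rowiE // mem_rowset => /existsP[i /eqP ->] a j.
by have := vc i j; rewrite !mxE ord1.
Qed.

(** Each stratum of U is cut out by an open set of matrices, hence covered by countably many
    rational boxes inside it. Their separated parts are compact, with compact images under
    [rowi]. *)
Lemma indepset_open_sigma_compact (U : set I) : open U ->
  exists K : nat -> set I, (forall i, compact (K i)) /\ U = \bigcup_i K i.
Proof.
move=> /indepset_openP oU.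
pose Q k (W : set 'M[R]_(k, n)) :=
  open W /\ forall v, sepmx v -> (U (rowi t v) <-> W v).
(* For k > t the choice may be arbitrary; the guard on [tag c] in [B] discards those values. *)
pose W k : set 'M[R]_(k, n) := xget set0 [set W | Q k W].
have WP k : (k <= t)%N -> Q k (W k).
  by move=> kt; have [W0 oW UW] := oU k kt; apply: (@xgetPex _ _ [set W | Q k W]); exists W0.
pose T := {k : nat & ('M[rat]_(k, n) * nat)%type}.
pose B (c : T) : set I := if (tag c <= t)%N && `[< @qbox R _ _ (tagged c) `<=` W (tag c) >]
  then @rowi R n t _ @` (@qbox R _ _ (tagged c) `&` @sepmx R n (tag c)) else set0.
exists (fun i => if choice.unpickle i is Some c then B c else set0); split=> [i|].
  case: choice.unpickle => [c|]; last exact: compact0.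
  rewrite /B; case: ifP => [/andP[kt _]|_]; last exact: compact0.
  apply: continuous_compact.
    apply: continuous_subspaceW (@rowi_continuous R n t _ kt).
    by move=> v [].
  by apply: compact_closedI; [exact: cbox_compact | exact: sepmx_closed].
apply/seteqP; split=> [S US|S [i _]].
  have St := indepset_card S; have [v [sv vS _]] := indepset_rowi (erefl #|` S|).
  have [oW UW] := WP _ St.
  have : W _ v by apply/UW => //; rewrite vS.
  rewrite (open_bigcup_qbox oW) => -[c /= cW cv].
  exists (choice.pickle (Tagged (fun k => ('M[rat]_(k, n) * nat)%type) c : T)) => //.
  by rewrite choice.pickleK /B /= St /= asboolT //; exists v.
case: choice.unpickle => [c|] //; rewrite /B; case: ifP => // /andP[kt /asboolP cW] [v [vc sv] <-].
by apply/(WP _ kt).2 => //; exact: cW.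
Qed.

End indepset_functions.

(** * Translations and continuity of A_t f *)

Section indepset_maps.
Variables (R : realType) (n : nat).

Lemma rowi_comp_continuous t k (T : topologicalType) (A : set T) (f : T -> 'M[R]_(k, n)) :
  (k <= t)%N -> {within A, continuous f} -> (forall x, A x -> sepmx (f x)) ->
  {within A, continuous (fun x => rowi t (f x))}.
Proof.
move=> kt /continuousP cf fA; apply/continuousP => U /indepset_openP/(_ k kt)[W oW UW].
have /open_subspaceP[V oV VE] := cf _ oW.
apply/open_subspaceP; exists V => //; rewrite VE.
by apply/seteqP; split=> x [fx Ax]; split=> //; apply/(UW _ (fA _ Ax)).
Qed.

Definition shiftmx k (x : 'rV[R]_n) (v : 'M[R]_(k, n)) : 'M[R]_(k, n) :=
  \matrix_(i, j) (v i j + x 0 j).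

Lemma row_shiftmx k (x : 'rV[R]_n) (v : 'M[R]_(k, n)) i :
  row i (shiftmx x v) = row i v + x.
Proof. by apply/rowP => j; rewrite !mxE. Qed.

Lemma edistDr (x y z : 'rV[R]_n) : edist (x + z) (y + z) = edist x y.
Proof.
by congr Num.sqrt; apply: eq_bigr => i _; rewrite !mxE opprD addrACA subrr addr0.
Qed.

Lemma shiftmx_sepmx k (x : 'rV[R]_n) (v : 'M[R]_(k, n)) : sepmx v -> sepmx (shiftmx x v).
Proof. by move=> sv i j ij; rewrite !row_shiftmx edistDr; exact: sv. Qed.

Lemma translateE t (x : 'rV[R]_n) (S : indepset R n t) :
  translate x S = [fset (y + x)%R | y in (S : {fset _})]%fset :> {fset _}.
Proof. by []. Qed.

Lemma translate_rowi t k (x : 'rV[R]_n) (v : 'M[R]_(k, n)) : (k <= t)%N -> sepmx v ->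
  translate x (rowi t v) = rowi t (shiftmx x v).
Proof.
move=> kt sv; apply: val_inj; rewrite /= !rowiE //; last exact: shiftmx_sepmx.
apply/fsetP => y; apply/imfsetP/idP => [[z /=]|].
  rewrite mem_rowset => /existsP[i /eqP ->] ->.
  by rewrite -row_shiftmx row_rowset.
rewrite mem_rowset => /existsP[i /eqP ->]; exists (row i v); first exact: row_rowset.
by rewrite row_shiftmx.
Qed.

Lemma continuous_translate_vec t (S : indepset R n t) :
  continuous (fun x : 'rV[R]_n => translate x S).
Proof.
have [v [sv vS _]] := indepset_rowi (erefl #|` S|).
rewrite (_ : (fun _ => _) = (fun x => rowi t (shiftmx x v))); last first.
  by apply/funext => x; rewrite -translate_rowi ?indepset_card // vS.
apply/continuous_subspace_setT; apply: rowi_comp_continuous (indepset_card S) _ _.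
  apply: continuous_subspaceT; apply: continuous_mx => i j x.
  rewrite (_ : (fun _ => _) = (fun x : 'rV[R]_n => v i j + x 0 j)); last first.
    by apply/funext => y; rewrite mxE.
  by apply: contD; [exact: cst_continuous | exact: coord_continuous].
by move=> x _; exact: shiftmx_sepmx.
Qed.

Lemma continuous_translate t (x : 'rV[R]_n) :
  continuous (@translate R n t x).
Proof.
apply: indepset_continuousP => k kt.
apply: (@subspace_eq_continuous _ _ _ (fun v => rowi t (shiftmx x v))).
  by move=> v /set_mem sv; rewrite -translate_rowi.
apply: rowi_comp_continuous => //; last by move=> v; exact: shiftmx_sepmx.
apply: continuous_subspaceT; apply: continuous_mx => i j v.
rewrite (_ : (fun _ => _) = (fun v : 'M[R]_(k, n) => v i j + x 0 j)); last first.
  by apply/funext => y; rewrite mxE.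
by apply: contD; [exact: coord_continuous | exact: cst_continuous].
Qed.

(** Subsets of the row set are parametrized by fixed sets of row indices, so that the chosen subset
    varies continuously with the matrix. *)
Definition selrows k (X : {set 'I_k}) (v : 'M[R]_(k, n)) : {fset 'rV[R]_n} :=
  [fset row i v | i in X]%fset.

Lemma mem_selrows k (X : {set 'I_k}) (v : 'M[R]_(k, n)) x :
  reflect (exists2 i, i \in X & x = row i v) (x \in selrows X v).
Proof. exact: imfsetP. Qed.

Lemma selrows_rowset k (X : {set 'I_k}) (v : 'M[R]_(k, n)) :
  selrows X v = rowset (rowsub (@enum_val _ (mem X)) v).
Proof.
apply/fsetP => x; rewrite mem_rowset; apply/mem_selrows/existsP => [[i iX ->]|[j /eqP ->]].
  exists (enum_rank_in iX i); apply/eqP/rowP => a.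
  by rewrite !mxE enum_rankK_in.
exists (enum_val j); first exact: enum_valP.
by apply/rowP => a; rewrite !mxE.
Qed.

Lemma sepmx_rowsub k l (f : 'I_l -> 'I_k) (v : 'M[R]_(k, n)) : injective f ->
  sepmx v -> sepmx (rowsub f v).
Proof.
move=> fi sv i j ij.
have rE a : row a (rowsub f v) = row (f a) v by apply/rowP => b; rewrite !mxE.
by rewrite !rE; apply: sv; apply: contra_neq ij => /fi.
Qed.

Lemma card_selrows k (X : {set 'I_k}) (v : 'M[R]_(k, n)) : injmx v ->
  #|` selrows X v| = #|X|.
Proof. by move=> /injmxP iv; rewrite card_imfset //= -cardE. Qed.

Lemma mem_row_selrows k (X : {set 'I_k}) (v : 'M[R]_(k, n)) i : injmx v ->
  (row i v \in selrows X v) = (i \in X).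
Proof.
move=> /injmxP iv; apply/mem_selrows/idP => [[j jX /iv ->] //|iX]; by exists i.
Qed.

Lemma selrows_inj k (v : 'M[R]_(k, n)) : injmx v -> injective (fun X => selrows X v).
Proof.
by move=> iv X Y e; apply/setP => i; rewrite -!(mem_row_selrows _ _ iv) e.
Qed.

Lemma big_fpowerset_rowset k (v : 'M[R]_(k, n)) (V : nmodType) (P : pred {fset 'rV[R]_n})
    (F : {fset 'rV[R]_n} -> V) : injmx v ->
  \sum_(J <- fpowerset (rowset v) | P J) F J =
  \sum_(X : {set 'I_k} | P (selrows X v)) F (selrows X v).
Proof.
move=> iv; rewrite -(big_map (fun X => selrows X v) P F); apply: perm_big.
apply: uniq_perm; first exact: fset_uniq.
  by rewrite map_inj_uniq ?index_enum_uniq //; exact: selrows_inj.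
move=> J; rewrite fpowersetE; apply/idP/mapP => [/fsubsetP Jv|[X _ ->]].
  exists [set i | row i v \in J]%SET; first exact: mem_index_enum.
  apply/fsetP => x; apply/idP/mem_selrows => [xJ|[i]]; last by rewrite inE => + ->.
  have := Jv x xJ; rewrite mem_rowset => /existsP[i /eqP e].
  by exists i => //; rewrite inE -e.
by apply/fsubsetP => x /mem_selrows[i _ ->]; exact: row_rowset.
Qed.

Lemma selrowsU k (X Y : {set 'I_k}) (v : 'M[R]_(k, n)) : injmx v ->
  ((selrows X v `|` selrows Y v)%fset == rowset v) = (X :|: Y == [set: 'I_k])%SET.
Proof.
move=> iv; apply/eqP/eqP => [e|e].
  apply/setP => i; rewrite inE -!(mem_row_selrows _ _ iv) -in_fsetU e.
  by rewrite row_rowset mem_row_selrows // inE.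
apply/fsetP => x; rewrite in_fsetU mem_rowset; apply/orP/existsP.
  by case=> /mem_selrows[i _ ->]; exists i.
move=> [i /eqP ->]; rewrite !mem_row_selrows //; apply/orP.
by have : i \in (X :|: Y)%SET; [rewrite e inE | rewrite inE].
Qed.

(** On the stratum of size k, the pairs with union S correspond to the pairs of index sets covering
    ['I_k]. This range does not depend on the matrix, so A_t f is a fixed finite sum of continuous
    terms there. *)
Lemma A_op_continuous t (f : indepset R n t * indepset R n t -> R) :
  continuous f -> continuous (A_op f).
Proof.
move=> cf; apply: indepset_continuousP => k kt.
pose g (v : 'M[R]_(k, n)) := \sum_(X : {set 'I_k} | (#|X| <= t)%N)
  \sum_(Y : {set 'I_k} | (#|Y| <= t)%N && (X :|: Y == [set: 'I_k])%SET)
    f (toindep t (selrows X v), toindep t (selrows Y v)).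
apply: (@subspace_eq_continuous _ _ _ g).
  move=> v /set_mem sv; have iv := sepmx_inj sv.
  rewrite -[RHS]/(A_op f (rowi _ v)).
  have rE := @rowiE R n (2 * t) k v kt sv.
  rewrite (@A_opE _ _ _ _ _ (rowset v)) ?rE //; last exact: sepmx_independent.
  rewrite big_fpowerset_rowset //; apply: eq_big => X; first by rewrite card_selrows.
  move=> _; rewrite big_fpowerset_rowset //; apply: eq_bigl => Y.
  by rewrite card_selrows // selrowsU.
have cs (X : {set 'I_k}) : (#|X| <= t)%N ->
    {within @sepmx R n k, continuous (fun v => toindep t (selrows X v))}.
  move=> Xt; under eq_fun do rewrite selrows_rowset.
  apply: (@rowi_comp_continuous t #|X| _ _ (fun v => rowsub (@enum_val _ (mem X)) v)) => //.
    apply: continuous_subspaceT; apply: continuous_mx => i j v.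
    rewrite (_ : (fun _ => _) = (fun v : 'M[R]_(k, n) => v (enum_val i) j)).
      exact: coord_continuous.
    by apply/funext => w; rewrite mxE.
  by move=> v sv; apply: sepmx_rowsub => //; exact: enum_val_inj.
apply: (@continuous_sumr _ (subspace (@sepmx R n k))) => X Xt.
apply: (@continuous_sumr _ (subspace (@sepmx R n k))) => Y /andP[Yt _] v.
apply: (@continuous_comp _ _ _ (fun v : subspace (@sepmx R n k) =>
  (toindep t (selrows X v), toindep t (selrows Y v))) f); last exact: cf.
exact: (cvg_pair (cs X Xt v) (cs Y Yt v)).
Qed.

End indepset_maps.

(** * Locally finite Borel measures are Radon on a sigma-compact space *)

Section radon_criterion.
Context (R : realType) (T : ptopologicalType).
Hypothesis hT : hausdorff_space T.
Hypothesis sigma_compact_open : forall U : set T, open U ->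
  exists K : nat -> set T, (forall i, compact (K i)) /\ U = \bigcup_i K i.

Local Lemma compact_exhaustion (U : set T) : open U ->
  exists K : nat -> set T, [/\ forall i, compact (K i),
    {homo K : i j / (i <= j)%N >-> (i <= j)%O} & U = \bigcup_i K i].
Proof.
move=> /sigma_compact_open[K [cK ->]].
exists (fun i => \bigcup_(j < i.+1) K j); split=> [i|i j ij|].
- by rewrite bigcup_mkord; exact: bigsetU_compact.
- by apply/subsetPset => x [k /= ki Kx]; exists k => //=; exact: leq_trans ij.
- apply/seteqP; split=> [x [i _ Kx]|x [i _ [j _ Kx]]]; last by exists j.
  by exists i => //; exists i => /=.
Qed.

Local Lemma bigcup_closed_mono (F : nat -> set T) : (forall i, closed (F i)) ->
  forall i, closed (\bigcup_(j < i) F j).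
Proof. by move=> cF i; apply: closed_bigcup. Qed.

Section finite_measure.
Variable m : {measure set (borel T) -> \bar R}.
Hypothesis mfin : (m setT < +oo)%E.

(** Inner approximation is by closed sets instead of compact ones, which makes the property stable
    under complement. *)
Definition sandwiched (B : set T) := forall e : R, 0 < e -> exists F U : set T,
  [/\ closed F, open U, F `<=` B, B `<=` U & (m (U `\` F) <= e%:E)%E].

Local Lemma mlty (B : set (borel T)) : measurable B -> (m B < +oo)%E.
Proof. by move=> mB; apply: le_lt_trans mfin; apply: le_measure; rewrite ?inE. Qed.

(** Continuity from above at the empty set, for which finiteness of the measure is essential. *)
Local Lemma increasing_gap (F : nat -> set T) (e : R) : 0 < e ->
  (forall i, closed (F i)) -> {homo F : i j / (i <= j)%N >-> (i <= j)%O} ->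
  exists i, (m ((\bigcup_i F i) `\` F i) <= e%:E)%E.
Proof.
move=> e0 cF mF; pose B : set (borel T) := \bigcup_i F i.
have mFi i : measurable (F i : set (borel T)) by exact: borel_closed.
have mB : measurable B by exact: bigcup_measurable.
have mBF i : measurable (B `\` F i : set (borel T)) by exact: measurableD.
have cap0 : \bigcap_i (B `\` F i) = set0.
  apply/seteqP; split=> // x h; have [[i _ Fx] _] := h 0%N I.
  by have [_] := h i I.
have m0 : measurable (\bigcap_i (B `\` F i) : set (borel T)) by rewrite cap0.
have mono : {homo (fun i => B `\` F i) : i j / (i <= j)%N >-> (j <= i)%O}.
  by move=> i j ij; apply/subsetPset => x [Bx nF]; split=> // Fx; apply: nF;
     move/subsetPset: (mF _ _ ij); exact.
have := nonincreasing_cvg_mu (mu := m) (mlty (mBF 0%N)) mBF m0 mono.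
rewrite cap0 measure0 => cv; apply: contrapT => /forallNP h.
have : (e%:E <= 0)%E.
  apply: cvge_ge cv; apply: nearW => i /=.
  by rewrite ltW // ltNge; apply/negP; exact: h.
by rewrite lee_fin leNgt e0.
Qed.

Local Lemma sandwiched_open (U : set T) : open U -> sandwiched U.
Proof.
move=> oU e e0; have [K [cK mK UE]] := compact_exhaustion oU.
have [i ie] := increasing_gap e0 (fun i => compact_closed hT (cK i)) mK.
exists (K i), U; split=> //; first exact: compact_closed.
  by rewrite UE; exact: bigcup_sup.
by rewrite UE.
Qed.

Local Lemma sandwiched_setC (B : set T) : sandwiched B -> sandwiched (~` B).
Proof.
move=> sB e e0; have [F [U [cF oU FB BU mUF]]] := sB e e0.
exists (~` U), (~` F); split.
- exact: open_closedC.
- exact: closed_openC.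
- exact: subsetC.
- exact: subsetC.
- by rewrite setDE setCK setIC -setDE.
Qed.

Local Lemma sandwiched_bigcup (B : nat -> set T) : (forall i, sandwiched (B i)) ->
  sandwiched (\bigcup_i B i).
Proof.
move=> sB e e0.
(* The gaps e / 2 / 2^(i+1) add up to e / 2. The other half of e pays for keeping only finitely many
   of the closed sets, since their countable union need not be closed. *)
have /choice[FU FUP] : forall i, exists FU : set T * set T,
    [/\ closed FU.1, open FU.2, FU.1 `<=` B i, B i `<=` FU.2 &
      (m (FU.2 `\` FU.1) <= (e / 2 / (2 ^ i.+1)%:R)%:E)%E].
  move=> i; have [|F [U H]] := sB i (e / 2 / (2 ^ i.+1)%:R).
    by rewrite !divr_gt0 // ltr0n expn_gt0.
  by exists (F, U).
pose F i := (FU i).1; pose U i := (FU i).2.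
have cF i : closed (F i) by have [] := FUP i.
have oU i : open (U i) by have [] := FUP i.
have cG := bigcup_closed_mono cF.
have e20 : 0 < e / 2 by rewrite divr_gt0.
have [|N Ne] := increasing_gap e20 cG.
  by move=> i j ij; apply/subsetPset => x [k /= ki Fx]; exists k => //=; exact: leq_trans ij.
exists (\bigcup_(j < N) F j), (\bigcup_i U i); split=> //.
- by apply: bigcup_open => i _; exact: oU.
- by move=> x [i _ Fx]; exists i => //; have [_ _ FB _ _] := FUP i; exact: FB.
- by move=> x [i _ Bx]; exists i => //; have [_ _ _ BU _] := FUP i; exact: BU.
have mF i : measurable (F i : set (borel T)) by exact: borel_closed.
have mU i : measurable (U i : set (borel T)) by exact: borel_open.
have mG i : measurable (\bigcup_(j < i) F j : set (borel T)) by exact: borel_closed.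
pose G : set (borel T) := \bigcup_i \bigcup_(j < i) F j.
have mmG : measurable G by exact: bigcup_measurable.
pose H : set (borel T) := \bigcup_i (U i `\` F i).
have mH : measurable H by apply: bigcup_measurable => i _; exact: measurableD.
have mGN : measurable (G `\` \bigcup_(j < N) F j) by exact: measurableD.
apply: (@le_trans _ _ (m (H `|` (G `\` \bigcup_(j < N) F j)))).
  apply: le_measure; rewrite ?inE.
  - by apply: measurableD => //; apply: bigcup_measurable => i _; exact: mU.
  - exact: measurableU.
  - move=> x [[i _ Ux] nFx].
    have [Fx|nFi] := pselect (F i x); last by left; exists i.
    by right; split=> //; exists i.+1 => //; exists i => /=.
apply: (le_trans (measureU2 _ _ _)) => //.
rewrite (splitr e) EFinD leeD //.
apply: le_trans (epsilon_trick0 xpredT (ltW e20)).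
apply: (@le_trans _ _ (\sum_(0 <= i <oo) m (U i `\` F i))%E).
  by apply: measure_sigma_subadditive => // i; exact: measurableD.
by apply: lee_nneseries => // i _ ; have [] := FUP i.
Qed.

Lemma borel_sandwiched (B : set (borel T)) : measurable B -> sandwiched B.
Proof.
move: B; apply: smallest_sub; last by move=> U oU; exact: sandwiched_open.
split=> [|A sA|A sA].
- by apply: sandwiched_open; exact: open0.
- by rewrite setTD; exact: sandwiched_setC.
- exact: sandwiched_bigcup.
Qed.

End finite_measure.

(** Outer regularity is localized: the finite case applies to the restriction of mu to each [O i],
    and the resulting open sets are glued with errors e / 2^(i+1). Inner regularity on open sets is
    continuity from below along a compact exhaustion. *)
Lemma radonP (mu : {measure set (borel T) -> \bar R}) (O : nat -> set T) :
  (forall i, open (O i)) -> (forall i, (mu (O i) < +oo)%E) ->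
  (forall K, compact K -> exists i, K `<=` O i) -> radon mu.
Proof.
move=> oO Ofin exh.
have mO i : measurable (O i : set (borel T)) by exact: borel_open.
have mK K : compact K -> measurable (K : set (borel T)).
  by move=> cK; apply: borel_closed; exact: compact_closed.
split.
- move=> K cK; have [i KO] := exh K cK.
  by apply: le_lt_trans (Ofin i); apply: le_measure; rewrite ?inE //; exact: mK.
- move=> B mB; apply/eqP; rewrite eq_le; apply/andP; split.
    apply: le_ereal_inf_tmp => _ [U [oU BU] <-]; apply: le_measure; rewrite ?inE //.
    exact: borel_open.
  apply/lee_addgt0Pr => e e0.
  have H i : exists U : set T, [/\ open U, B `<=` U &
      (mu ((U `&` O i) `\` B) <= (e / (2 ^ i.+1)%:R)%:E)%E].
    have fin : (mrestr mu (mO i) setT < +oo)%E by rewrite /mrestr setTI.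
    have [|F [U [cF oU FB BU h]]] := borel_sandwiched fin mB (e := e / (2 ^ i.+1)%:R).
      by rewrite divr_gt0 // ltr0n expn_gt0.
    exists U; split=> //; apply: le_trans h; rewrite /= /mrestr; apply: le_measure; rewrite ?inE.
    + by apply: measurableD => //; apply: measurableI => //; exact: borel_open.
    + apply: measurableI => //; apply: measurableD; [exact: borel_open | exact: borel_closed].
    + by move=> x [[Ux Ox] nBx]; split=> //; split=> // /FB.
  have /choice[U UP] := H.
  pose V := \bigcup_i (U i `&` O i).
  have oV : open V by apply: bigcup_open => i _; apply: openI => //; have [] := UP i.
  have BV : B `<=` V.
    move=> x Bx; have [i xO] := exh [set x] (@compact_set1 _ x).
    by exists i => //; split; [have [_ BU _] := UP i; exact: BU | exact: xO].
  have mV : measurable (V : set (borel T)) by exact: borel_open.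
  apply: (@le_trans _ _ (mu V)).
    by apply: ereal_inf_lbound; exists V.
  rewrite -[in leLHS](setDUK BV); apply: (le_trans (measureU2 _ _ _)) => //.
    exact: measurableD.
  rewrite leeD2l //; apply: le_trans (epsilon_trick0 xpredT (ltW e0)).
  apply: (@le_trans _ _ (\sum_(0 <= i <oo) mu ((U i `&` O i) `\` B))%E); last first.
    by apply: lee_nneseries => // i _; have [] := UP i.
  apply: measure_sigma_subadditive => //.
  + move=> i; apply: measurableD => //; apply: measurableI => //.
    by apply: borel_open; have [] := UP i.
  + exact: measurableD.
  + by move=> x [[i _ UO] nB]; exists i.
- move=> U oU; apply/eqP; rewrite eq_le; apply/andP; split; last first.
    apply: ge_ereal_sup => _ [K [cK KU] <-]; apply: le_measure; rewrite ?inE //.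
      exact: mK.
    exact: borel_open.
  have [K [cK ndK UE]] := compact_exhaustion oU.
  have mKi i : measurable (K i : set (borel T)) by exact: mK.
  have mU : measurable (\bigcup_i K i : set (borel T)) by exact: bigcup_measurable.
  have := nondecreasing_cvg_mu (mu := mu) mKi mU ndK.
  rewrite -UE => cv; apply: cvge_le cv; apply: nearW => i /=.
  apply: ereal_sup_ubound; exists (K i) => //; split=> //.
  by rewrite UE; exact: bigcup_sup.
Qed.

End radon_criterion.

(** * Positivity and supports of kernels, boundedness of compact families *)

Lemma big_fpowerset_imfset (K K' : choiceType) (h : K -> K') (X : {fset K}) (V : nmodType)
    (P : pred {fset K'}) (F : {fset K'} -> V) : injective h ->
  \sum_(S <- fpowerset (h @` X)%fset | P S) F S =
  \sum_(A <- fpowerset X | P (h @` A)%fset) F (h @` A)%fset.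
Proof.
move=> hi; pose g (A : {fset K}) : {fset K'} := (h @` A)%fset.
have gi : injective g.
  move=> A B e; apply/fsetP => a.
  have mh (C : {fset K}) : (h a \in g C) = (a \in C) by rewrite mem_imfset.
  by rewrite -!mh e.
suff pe : perm_eq (fpowerset (h @` X)%fset) [seq g A | A <- fpowerset X].
  by rewrite (perm_big _ pe) big_map.
apply: uniq_perm; first exact: fset_uniq.
  by rewrite map_inj_uniq ?fset_uniq.
move=> S; rewrite fpowersetE; apply/idP/mapP => [/fsubsetP SX|[A + ->]].
  exists [fset a in X | h a \in S]%fset.
    by rewrite fpowersetE; apply/fsubsetP => a; rewrite !inE => /andP[].
  apply/fsetP => y; apply/idP/imfsetP => [yS|[a /=]]; last by rewrite !inE => /andP[_ +] ->.
  have /imfsetP[a /= aX ya] := SX y yS.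
  by exists a => //; rewrite !inE aX -ya.
rewrite fpowersetE => /fsubsetP AX; apply/fsubsetP => _ /imfsetP[a /= aA ->].
by apply/imfsetP; exists a => //; exact: AX.
Qed.

Section kernels.
Variables (R : realType) (n t : nat) (K : indepset R n t * indepset R n t -> R).

Lemma psd_sum_ge0 (Z : {fset 'rV[R]_n}) : independent Z -> psd_kernel K ->
  0 <= \sum_(J <- fpowerset Z | (#|` J| <= t)%N) \sum_(J' <- fpowerset Z | (#|` J'| <= t)%N)
    K (toindep t J, toindep t J').
Proof.
move=> iZ [_ psd].
pose r : seq {fset 'rV[R]_n} := [seq J <- fpowerset Z | (#|` J| <= t)%N].
have rE (J : {fset 'rV[R]_n}) : J \in r -> toindep t J = J :> {fset _}.
  rewrite mem_filter fpowersetE => /andP[Jt JZ].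
  by rewrite toindepK //; exact: independent_sub iZ.
pose S : {fset indepset R n t} := [fset toindep t J | J in r]%fset.
have SE (F : indepset R n t -> R) : \sum_(x <- S) F x = \sum_(J <- r) F (toindep t J).
  rewrite -(big_map (toindep t) predT F); apply: perm_big; apply: uniq_perm.
  - exact: fset_uniq.
  - rewrite map_inj_in_uniq ?filter_uniq ?fset_uniq // => J J' /rE e /rE e' h.
    by rewrite -e -e' h.
  - move=> x; apply/imfsetP/mapP => [[J /= Jr ->]|[J Jr ->]]; by exists J.
(* Unit weights on the subsets of Z with at most t points. *)
have := psd S (fun _ => 1); rewrite SE; under eq_bigr do rewrite SE.
rewrite big_filter; under eq_bigr do rewrite big_filter.
by under eq_bigr do under eq_bigr do rewrite !mul1r.
Qed.

Lemma A_op_support (Q : set 'rV[R]_n) (S : indepset R n (2 * t)) :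
  (forall p, K p != 0 -> (forall x, x \in (p.1 : {fset _}) -> Q x) /\
     (forall x, x \in (p.2 : {fset _}) -> Q x)) ->
  A_op K S != 0 -> forall x, x \in (S : {fset _}) -> Q x.
Proof.
move=> KQ + x xS; have iS := @indepset_independent _ _ _ S.
rewrite (A_opE K iS (fsubset_refl _)) => nz; apply: contrapT => Qx.
move/eqP: nz; apply; rewrite big_seq_cond big1 // => J /andP[].
rewrite fpowersetE => JS Jt; rewrite big_seq_cond big1 // => J' /and3P[].
rewrite fpowersetE => J'S J't /eqP JJ'; apply/eqP/negPn/negP => /KQ[/= h h'].
have := xS; rewrite -JJ' in_fsetU => /orP[] xJ.
  by apply/Qx/h; rewrite toindepK //; exact: independent_sub iS.
by apply/Qx/h'; rewrite toindepK //; exact: independent_sub iS.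
Qed.

End kernels.

(** The sum of the norms is a continuous function of the set and dominates the norm of each of its
    points. *)
Lemma compact_indepset_bounded (R : realType) (n t : nat) (Q : set (indepset R n t)) :
  compact Q -> exists r, forall S, Q S -> \sum_(x <- (S : {fset _})) `|x| < r.
Proof.
move=> cQ.
have cs : continuous (fun S : indepset R n t => \sum_(x <- (S : {fset _})) `|x|).
  by apply: continuous_indepset_sum; exact: norm_continuous.
have /compact_bounded[M [_ MP]] := continuous_compact (continuous_subspaceT cs) cQ.
exists (M + 2) => S QS.
have := MP (M + 1) ltac:(by rewrite ltrDl) _ (ex_intro2 _ _ S QS erefl).
by move=> /(le_trans (ler_norm _)) => h; apply: le_lt_trans h _; rewrite ltrD2l ltr1n.
Qed.

Lemma norm_sum_cbox (R : realType) (n : nat) (S : {fset 'rV[R]_n}) r :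
  \sum_(x <- S) `|x| < r -> forall x, x \in S -> cbox 0 r x.
Proof.
move=> Sr x xS i j; rewrite mxE sub0r normrN; apply: le_trans (ler_mx_norm_entry _ _ _) _.
apply: le_trans (ltW Sr); rewrite (big_fsetD1 x) //= lerDl.
by apply: sumr_ge0 => y _; exact: normr_ge0.
Qed.

(** * The upper bound *)

Lemma fset1_seq (K : choiceType) (x : K) : [fset x]%fset = [:: x] :> seq K.
Proof.
apply: perm_small_eq => //; apply: uniq_perm; rewrite ?fset_uniq // => y.
by rewrite in_fset1 inE.
Qed.

Section upper_bound.
Variables (R : realType) (n t : nat) (L N e : R).
Hypotheses (e0 : 0 < e) (eL : e < L / 2) (Nt : N <= t%:R).
Let c : 'rV[R]_n := const_mx (L / 2).
Let C := cbox c (L / 2).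
Hypothesis packN : forall S : {fset 'rV[R]_n}, independent S -> [set` S] `<=` C ->
  (#|` S|)%:R <= N.

(** A ramp of width e: 1 on the cube [e, L - e]^n, 0 outside [0, L]^n, and continuous as kernels
    have to be. *)
Definition bump (x : 'rV[R]_n) : R := Num.min 1 (Num.max 0 ((L / 2 - `|x - c|) / e)).

Lemma bump_continuous : continuous bump.
Proof.
apply: cont_min; first exact: cst_continuous.
apply: cont_max; first exact: cst_continuous.
apply: contM; last exact: cst_continuous.
apply: contB; first exact: cst_continuous.
move=> x; apply: continuous_comp; last exact: norm_continuous.
by apply: continuousB; [exact: cvg_id | exact: cst_continuous].
Qed.

Lemma bump_ge0 x : 0 <= bump x.
Proof. by rewrite /bump le_min ler01 le_max lexx. Qed.

Lemma bump_le1 x : bump x <= 1.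
Proof. by rewrite /bump ge_min lexx. Qed.

Lemma bump_out x : ~ C x -> bump x = 0.
Proof.
move=> Cx; rewrite /bump (max_idPl _) ?min_r ?ler01 //.
rewrite pmulr_lle0 ?invr_gt0 // subr_le0 leNgt; apply/negP => xc; apply: Cx => i j.
rewrite distrC; apply: le_trans (ltW xc).
by have := ler_mx_norm_entry (x - c) i j; rewrite !mxE.
Qed.

Lemma bump_in x : `|x - c| <= L / 2 - e -> bump x = 1.
Proof.
move=> xc; rewrite /bump min_l // le_max; apply/orP; right.
by rewrite ler_pdivlMr // mul1r lerBrDl -lerBrDr.
Qed.

Lemma sum_bump_le (S : {fset 'rV[R]_n}) : independent S -> \sum_(x <- S) bump x <= N.
Proof.
move=> iS; pose S' := [fset x in S | `[< C x >]]%fset.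
have S'S : (S' `<=` S)%fset by apply/fsubsetP => x; rewrite !inE => /andP[].
apply: le_trans (packN (independent_sub S'S iS) _); last first.
  by move=> x /=; rewrite !inE => /andP[_ /asboolP].
rewrite -sum1_size natr_sum /= big_fset /= [leLHS](bigID (fun x => `[< C x >])) /=.
rewrite [X in _ + X]big1 ?addr0 => [|x /asboolP]; last exact: bump_out.
by apply: ler_sum => x _; exact: bump_le1.
Qed.

(* The rank-one kernel h(J) h(J') with h the Moebius inverse of
   S |-> sqrt (N - sum of bump over S): summing A_t of it over the subsets of an
   independent set Z gives N - sum of bump over Z, whose Moebius inverse is N on
   the empty set, -bump x on {x} and 0 elsewhere. *)
Definition sqrtdef (a : R) : R := Num.sqrt (N - a).

Lemma sqrtdef_continuous : continuous sqrtdef.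
Proof.
apply: continuous_sqrt_comp; apply: contB; first exact: cst_continuous.
by move=> x; exact: cvg_id.
Qed.

Definition kerfun (J : indepset R n t) : R :=
  mob sqrtdef [seq bump x | x <- (J : {fset _})] 0.

Definition ker (p : indepset R n t * indepset R n t) : R := kerfun p.1 * kerfun p.2.

Lemma mob_bump_eq0 (s : R -> R) (J : {fset 'rV[R]_n}) x : x \in J -> ~ C x ->
  mob s [seq bump x | x <- J] 0 = 0.
Proof.
by move=> xJ Cx; apply: mob_eq0; apply/mapP; exists x => //; rewrite bump_out.
Qed.

Lemma ker_continuous : continuous ker.
Proof.
have ck : continuous kerfun.
  by apply: continuous_indepset_mob; [exact: bump_continuous | exact: sqrtdef_continuous].
by apply: contM => p; apply: continuous_comp; [exact: cvg_fst | exact: ck | exact: cvg_snd | exact: ck].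
Qed.

Lemma ker_psd : psd_kernel ker.
Proof.
split=> [J J'|S w]; first by rewrite /ker /= mulrC.
rewrite (_ : \sum_(J <- S) _ = (\sum_(J <- S) w J * kerfun J) ^+ 2) ?sqr_ge0 //.
rewrite expr2 mulr_suml; apply: eq_bigr => J _; rewrite mulr_sumr; apply: eq_bigr => J' _.
by rewrite /ker /=; ring.
Qed.

Lemma ker_compact : compactly_supported ker.
Proof.
pose A := [set S : indepset R n t | forall x, x \in (S : {fset _}) -> C x].
have cA : compact A by exact: compact_subcube.
have clA : closed A by apply: compact_closed cA; exact: indepset_hausdorff.
apply: (@subclosed_compact _ _ (A `*` A)).
- exact: closed_closure.
- exact: compact_setX.
rewrite closureE => p; apply; split.
  rewrite (_ : A `*` A = (fst @^-1` A) `&` (snd @^-1` A)); last by apply/seteqP; split=> q [].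
  by apply: closedI; apply: closed_comp => // q _; [exact: cvg_fst | exact: cvg_snd].
move=> [J J'] /=; rewrite /ker /= mulf_eq0 negb_or => /andP[h h'].
split=> x xJ; apply: contrapT => Cx; [move/eqP: h | move/eqP: h']; apply.
  exact: mob_bump_eq0 xJ Cx.
exact: mob_bump_eq0 xJ Cx.
Qed.

Definition lindef (a : R) : R := N - a.

(** Both sides have the same sums over the subsets of every independent set with at most 2t points.
    Induction on the set cancels the proper subsets and leaves equality at the set itself. *)
Lemma A_op_ker (S : indepset R n (2 * t)) :
  A_op ker S = mob lindef [seq bump x | x <- (S : {fset _})] 0.
Proof.
have H Z : independent Z -> \sum_(S <- fpowerset Z | (#|` S| <= 2 * t)%N) A_op ker (toindep (2 * t) S) =
    N - \sum_(x <- Z) bump x.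
  move=> iZ; rewrite A_op_sum //.
  have sE : \sum_(J <- fpowerset Z | (#|` J| <= t)%N) kerfun (toindep t J) = sqrtdef (\sum_(x <- Z) bump x).
    rewrite -[\sum_(x <- Z) _]add0r -sum_mob_fpowerset big_mkcond /=.
    rewrite big_seq [RHS]big_seq; apply: eq_bigr => J; rewrite fpowersetE => JZ.
    have iJ := independent_sub JZ iZ.
    case: leqP => Jt; first by rewrite /kerfun toindepK.
    (* Truncation at t points loses nothing: an independent set with more than t >= N points cannot
       fit in the cube, and [mob] vanishes as soon as one point lies outside. *)
    have [x [xJ Cx]] : exists x, x \in J /\ ~ C x.
      apply: contrapT => /forallNP h; have := packN iJ.
      have JC : [set` J] `<=` C by move=> x /= xJ; apply: contrapT => Cx; apply: (h x).
      by move=> /(_ JC) /le_trans/(_ Nt); rewrite ler_nat leqNgt Jt.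
    by rewrite (mob_bump_eq0 _ xJ Cx).
  transitivity ((\sum_(J <- fpowerset Z | (#|` J| <= t)%N) kerfun (toindep t J)) ^+ 2).
    rewrite expr2 mulr_suml; apply: eq_bigr => J _; rewrite mulr_sumr; exact: eq_bigr.
  by rewrite sE sqr_sqrtr // subr_ge0; exact: sum_bump_le.
suff G Z : independent Z -> (#|` Z| <= 2 * t)%N ->
    A_op ker (toindep (2 * t) Z) = mob lindef [seq bump x | x <- Z] 0.
  by rewrite -[in LHS](toindep_val S) G //; [exact: indepset_independent | exact: indepset_card].
elim/finSet_rect: Z => Z IH iZ Zt.
have := H Z iZ; rewrite -[\sum_(x <- Z) _]add0r -[RHS]/(lindef _) -sum_mob_fpowerset.
rewrite big_mkcond /= !(bigD1_seq Z) ?fset_uniq ?fpowersetE ?fsubset_refl //= Zt.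
rewrite (_ : \sum_(i <- fpowerset Z | i != Z) _ =
  \sum_(i <- fpowerset Z | i != Z) mob lindef [seq bump x | x <- i] 0); first by move/addIr.
rewrite big_seq_cond [RHS]big_seq_cond; apply: eq_bigr => J.
rewrite fpowersetE => /andP[JZ nJZ].
have Jt : (#|` J| <= 2 * t)%N by apply: leq_trans Zt; exact: fsubset_leq_card.
rewrite Jt IH // ?fproperEneq ?nJZ //; exact: independent_sub iZ.
Qed.


(** Second differences of an affine function vanish. *)
Lemma mob_lindef_ge2 x y (l : seq R) a : mob lindef [:: x, y & l] a = 0.
Proof.
elim: l a => [|z l IH] a; first by rewrite /= /lindef; ring.
rewrite (@mob_perm _ _ _ (z :: [:: x, y & l])).
  by rewrite -[LHS]/(mob lindef [:: x, y & l] (a + z) - mob lindef [:: x, y & l] a) !IH subrr.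
by rewrite -[z :: _]cat1s perm_sym (perm_catCA [:: z] [:: x; y] l).
Qed.

Lemma cbox_norm (x : 'rV[R]_n) r : 0 <= r -> cbox c r x <-> `|x - c| <= r.
Proof.
move=> r0; split=> [xr|xr i j].
  rewrite -[leLHS]/(mx_norm _) mx_normrE; apply/bigmax_leP; split=> // -[i j] _ /=.
  by rewrite !mxE distrC; have := xr i j; rewrite !mxE.
rewrite distrC; apply: le_trans xr.
by have := ler_mx_norm_entry (x - c) i j; rewrite !mxE.
Qed.

Lemma bump_eq1 x : bump x = 1 -> `|x - c| <= L / 2 - e.
Proof.
rewrite /bump => h; rewrite lerBrDr -lerBrDl -[leLHS]mul1r -ler_pdivlMr //.
have : 1 <= Num.max 0 ((L / 2 - `|x - c|) / e) by rewrite -[leLHS]h ge_min lexx orbT.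
by rewrite le_max ler10.
Qed.

Lemma A_op_ker_spec (S : indepset R n (2 * t)) :
  (S = indepset0 R n (2 * t) /\ A_op ker S = N) \/
  (exists2 x, (S : {fset _}) = [fset x]%fset & A_op ker S = - bump x) \/
  ((1 < #|` S|)%N /\ A_op ker S = 0).
Proof.
rewrite A_op_ker; have [S0|S1] := posnP #|` S|.
  left; have S00 : (S : {fset _}) = fset0 by apply: cardfs0_eq.
  by split; [exact: val_inj | rewrite S00 /= /lindef subr0].
right; have [S2|S1'] := ltnP 1 #|` S|; [right | left].
  split=> //; move: S2; rewrite -(size_map bump).
  by case: [seq bump x | x <- _] => // a [|b l] // _; exact: mob_lindef_ge2.
have /cardfs1P[x Sx] : #|` S| == 1%N by rewrite eqn_leq S1' S1.
by exists x => //; rewrite Sx fset1_seq /= /lindef; ring.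
Qed.

Lemma N_ge0 : 0 <= N.
Proof.
have := @packN fset0; rewrite cardfs0; apply; first by move=> x y; rewrite in_fset0.
by move=> x /=; rewrite in_fset0.
Qed.

Variable mu : {measure set (borel (indepset R n (2 * t))) -> \bar R}.
Hypothesis feas : las_feasible mu.

Let B : set (indepset R n (2 * t)) :=
  [set S | exists2 x, cbox c (L / 2 - e) x & (S : {fset _}) = [fset x]%fset].

Let inner_ge0 : 0 <= L / 2 - e. Proof. by rewrite subr_ge0 ltW. Qed.

Lemma A_op_ker_continuous : continuous (A_op ker).
Proof. exact: A_op_continuous ker_continuous. Qed.

(** The singletons of the inner cube form a level set of a continuous function, hence a closed,
    measurable set: N >= 0 excludes the empty set, and the value on larger sets is 0. *)
Lemma singletonsE : B = A_op ker @^-1` [set -1].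
Proof.
apply/seteqP; split=> [S [x xB Sx]|S /= S1].
  rewrite /= A_op_ker Sx fset1_seq /= bump_in; last exact/cbox_norm.
  by rewrite /lindef; ring.
have [[_ SN]|[[x Sx Sb]|[_ S0]]] := A_op_ker_spec S.
- by have := N_ge0; rewrite -SN S1 lerNr oppr0 ler10.
- exists x => //; apply/cbox_norm => //; apply: bump_eq1.
  by apply: oppr_inj; rewrite -Sb S1.
- by move: S1; rewrite S0 => /eqP; rewrite eq_sym oppr_eq0 oner_eq0.
Qed.

Lemma singletons_measurable : measurable (B : set (borel (indepset R n (2 * t)))).
Proof.
apply: borel_closed; rewrite singletonsE; apply: closed_comp; last exact: closed_eq.
by move=> S _; exact: A_op_ker_continuous.
Qed.

Lemma mu_singletons_le : (mu B <= N%:E)%E.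
Proof.
have [_ _ mu0 pos] := feas.
have := pos _ ker_continuous ker_compact ker_psd.
have mf : measurable_fun setT (fun S : borel (indepset R n (2 * t)) => (A_op ker S)%:E).
  by apply/measurable_EFinP; apply: borel_continuous_real; exact: A_op_ker_continuous.
have m0 : measurable ([set indepset0 R n (2 * t)] : set (borel (indepset R n (2 * t)))).
  apply: borel_closed; apply: compact_closed; last exact: compact_set1.
  exact: indepset_hausdorff.
(* The positive part lives on the empty set, which has mass 1, and integrates to N. The negative
   part is at least the indicator of [B]. *)
rewrite integralE.
have -> : (\int[mu]_S (fun S => (A_op ker S)%:E)^\+ S = N%:E)%E.
  rewrite -[RHS]mule1 -mu0 -[in RHS](setIT [set _]) -integral_indic // -ge0_integralZl//; last 2 first.
  - by apply/measurable_EFinP; exact: measurable_indic.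
  - by rewrite lee_fin N_ge0.
  apply: eq_integral => S _; rewrite funeposE indicE.
  have [[-> ->]|[[x Sx ->]|[S2 ->]]] := A_op_ker_spec S.
  - by rewrite mem_set // mule1 (max_idPl _) // lee_fin N_ge0.
  - rewrite memNset ?mule0 ?(max_idPr _) ?lee_fin ?oppr_le0 ?bump_ge0 // => S0.
    by have := fset11 x; rewrite -Sx S0 in_fset0.
  - rewrite memNset ?mule0 ?(max_idPl _) // => S0.
    by move: S2; rewrite S0 cardfs0.
(* The first term is the finite number N, so the comparison is legitimate before the negative part
   is known to be integrable. *)
rewrite sube_ge0; last by apply/orP; right.
apply: le_trans; rewrite (_ : mu B = \int[mu]_S (\1_B S)%:E)%E; last first.
  by rewrite integral_indic ?setIT //; exact: singletons_measurable.
apply: ge0_le_integral => //.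
- apply/measurable_EFinP; apply: measurable_indic; exact: singletons_measurable.
- exact: measurable_funeneg.
move=> S _; rewrite funenegE indicE singletonsE.
have [SB|/negP SB] := boolP (S \in _); last by rewrite le_max lexx orbT.
by move/set_mem: SB => /= ->; rewrite opprK le_max lexx.
Qed.

Lemma hat0_inner_le : hat0 mu * (L - 2 * e) ^+ n <= N.
Proof.
set P := [set d : R | forall A : set (borel 'rV[R]_n), measurable A ->
  mu [set S : indepset R n (2 * t) | exists2 x, A x & (S : {fset 'rV[R]_n}) = [fset x]%fset] =
    (d%:E * lebesgue_rV A)%E].
have [[d Pd]|nP] := pselect (exists d, P d); last first.
  (* Should no multiple exist, [hat0 mu] takes its default value 0 and the bound reads 0 <= N. *)
  rewrite /hat0 xgetPN ?mul0r ?N_ge0 // => d Pd; apply: nP; by exists d.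
have := @xgetPex _ 0 P (ex_intro _ d Pd) (cbox c (L / 2 - e)).
move=> /(_ (borel_closed (@cbox_closed _ _ _ _ _))) E.
have := mu_singletons_le; rewrite E.
rewrite (_ : cbox c _ = [set x | forall i, `[e, L - e]%classic (x 0 i)]); last first.
  apply/seteqP; split=> [x xc i|x xc i j]; last first.
    have := xc j; rewrite !mxE (ord1 i) /= in_itv /= ler_distl => /andP[h1 h2].
    by apply/andP; split; lra.
  have := xc 0 i; rewrite !mxE /= in_itv /= ler_distl => /andP[h1 h2].
  by apply/andP; split; lra.
rewrite lebesgue_rV_cube // lebesgue_measure_itv /= lte_fin ifT; last by move: eL; lra.
by rewrite -EFinB -EFin_expe -EFinM lee_fin (_ : L - e - e = L - 2 * e) //; ring.
Qed.

End upper_bound.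

(** * The measure of a periodic packing *)

Section esum_lemmas.
Variable R : realType.
Local Open Scope ereal_scope.

Lemma esum_support (T : choiceType) (D D' : set T) (a : T -> \bar R) :
  D' `<=` D -> (forall x, D x -> 0 <= a x) -> (forall x, D x -> ~ D' x -> a x = 0) ->
  \esum_(x in D) a x = \esum_(x in D') a x.
Proof.
move=> DD a0 az; rewrite (esumID D') // (setIidr DD) [X in _ + X]esum1 ?adde0 //.
by move=> x [Dx nDx]; exact: az.
Qed.

(** Countable sums of measures are series over the natural numbers; this turns them into unordered
    sums over the index type, where reindexing and exchange apply. *)
Lemma nneseries_unpickle (T : countType) (D : set T) (a : T -> \bar R) (b : nat -> \bar R) :
  (forall x, D x -> 0 <= a x) ->
  (forall i, b i = if pickle_inv i is Some x then (if x \in D then a x else 0) else 0) ->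
  \sum_(0 <= i <oo) b i = \esum_(x in D) a x.
Proof.
move=> a0 bE.
have b0 i : 0 <= b i.
  by rewrite bE; case: pickle_inv => // x; case: ifPn => // /set_mem; exact: a0.
rewrite nneseries_esumT // (@esum_support _ _ [set choice.pickle x | x in D]) //; last first.
  move=> i _ nD; rewrite bE; case e : (pickle_inv i) => [x|] //.
  case: ifPn => // /set_mem Dx; exfalso; apply: nD; exists x => //.
  by have := pickle_invK (T := T) i; rewrite e.
rewrite esum_image; last by move=> x y _ _; exact: (pcan_inj pickleK_inv).
by apply: eq_esum => x Dx; rewrite bE pickleK_inv mem_set.
Qed.

Lemma esum_pZl (T : choiceType) (D : set T) (a : T -> \bar R) (c : R) : (0 < c)%R ->
  (forall x, 0 <= a x) -> (c%:E * (\esum_(x in D) a x) = \esum_(x in D) (c%:E * a x))%E.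
Proof.
move=> c0 a0; rewrite /esum -ereal_sup_pZl //; congr ereal_sup.
apply/seteqP; split=> y.
  move=> [_ [F FD <-] <-]; exists F => //; rewrite ge0_mule_fsumr //.
move=> [F FD <-]; exists (\sum_(i \in F) a i); first by exists F.
by rewrite ge0_mule_fsumr.
Qed.

Lemma esum_seq (T : choiceType) (r : seq T) (a : T -> \bar R) : uniq r ->
  (forall x, 0 <= a x) -> \esum_(x in [set` r]) a x = \sum_(x <- r) a x.
Proof. by move=> ur a0; rewrite fsbig_seq // esum_fset //; exact: finite_seq. Qed.

End esum_lemmas.

Section periodic_packing.
Variables (R : realType) (n : nat) (l : R) (S0 : {fset 'rV[R]_n}) (t : nat).
Hypothesis l0 : 0 <= l.
Hypothesis iS0 : independent S0.
Hypothesis S0l : forall s, s \in S0 -> forall i, 0 <= s 0 i <= l.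
Let p := l + 2.
Local Notation m := #|` S0|.
Local Notation V := 'rV[R]_n.
Local Notation Z := 'rV[int]_n.
Local Notation idx := ('rV[int]_n * 'I_m)%type.
Local Notation I := (indepset R n (2 * t)).

Let p0 : 0 < p. Proof. by rewrite /p; move: l0; lra. Qed.

Definition lat (z : Z) : V := \row_j (p * (z 0 j)%:~R).

Lemma latD z w : lat (z + w) = lat z + lat w.
Proof. by apply/rowP => j; rewrite !mxE intrD mulrDr. Qed.

Lemma latN z : lat (- z) = - lat z.
Proof. by apply/rowP => j; rewrite !mxE intrN mulrN. Qed.

(** Packing points are handled through a countable index type, so that finite subsets are countably
    many and lattice translations act on indices. *)
Definition pt (a : idx) : V := lat a.1 + nth 0 S0 a.2.

Lemma nthS0 (i : 'I_m) : nth 0 S0 i \in S0.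
Proof. by rewrite mem_nth. Qed.

(** Within one copy this is the independence of [S0]. Two different copies are offset by at least p
    in some coordinate, where points of [S0] differ by at most l, which leaves p - l = 2. *)
Lemma pt_sep a b : a != b -> 2 <= edist (pt a) (pt b).
Proof.
case: a b => [z i] [w j] ab; rewrite /pt /=.
have [zw|/eqP zw] := eqVneq z w.
  rewrite zw ![lat w + _]addrC edistDr; apply: iS0; rewrite ?nthS0 //.
  apply: contraNneq ab => e; rewrite zw; apply/eqP; congr pair.
  apply: val_inj => /=; apply/eqP; rewrite -(nth_uniq 0 _ _ (fset_uniq S0)) //.
  by apply/eqP.
have [k zk] : exists k, z 0 k != w 0 k.
  apply: contrapT => /forallNP h; apply: zw; apply/rowP => k.
  by apply/eqP/negPn/negP; exact: h.
apply: le_trans (edist_ge_coord _ _ k); rewrite !mxE.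
have /andP[s1 s2] := S0l (nthS0 i) k; have /andP[u1 u2] := S0l (nthS0 j) k.
set s := nth 0 S0 i 0 k in s1 s2 *; set u := nth 0 S0 j 0 k in u1 u2 *.
have : (1 : R) <= `|(z 0 k - w 0 k)%:~R|.
  by rewrite -intr_norm -[1]/(1%:~R) ler_int -gtz0_ge1 normr_gt0 subr_eq0.
rewrite (_ : _ - _ = p * (z 0 k - w 0 k)%:~R + (s - u)); last by rewrite intrB; ring.
move=> h; apply: le_trans (lerB_normD _ _); rewrite normrM (gtr0_norm p0).
have : p <= p * `|(z 0 k - w 0 k)%:~R| by rewrite ler_peMr // ltW.
have : `|s - u| <= l by rewrite ler_norml; apply/andP; split; lra.
rewrite /p; lra.
Qed.

Lemma pt_inj : injective pt.
Proof.
move=> a b e; apply/eqP/negPn/negP => /pt_sep; rewrite e edist0.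
by rewrite leNgt ltr0n.
Qed.

Definition packpts (A : {fset idx}) : {fset V} := [fset pt a | a in A]%fset.

Lemma packpts_independent A : independent (packpts A).
Proof.
move=> _ _ /imfsetP[a _ ->] /imfsetP[b _ ->] ab; apply: pt_sep.
by apply: contra_neq ab => ->.
Qed.

Lemma card_packpts A : #|` packpts A| = #|` A|.
Proof. by rewrite card_imfset //; exact: pt_inj. Qed.

Definition packset (A : {fset idx}) : I := toindep (2 * t) (packpts A).

Definition small : set {fset idx} := [set A | (#|` A| <= 2 * t)%N].

Lemma packsetE A : small A -> packset A = packpts A :> {fset _}.
Proof. by move=> At; rewrite toindepK ?card_packpts //; exact: packpts_independent. Qed.

Definition cell : set V := [set x | forall i, `[0, p[%classic (x 0 i)].

Lemma cell_measurable : @measurable _ (borel V) cell.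
Proof. by apply: measurable_cube; exact: measurable_itv. Qed.

Lemma lebm_cell : lebm R n cell = (p ^+ n)%:E.
Proof.
rewrite -lebmE lebesgue_rV_cube // lebesgue_measure_itv /= lte_fin p0.
by rewrite oppr0 adde0 EFin_expe.
Qed.

Lemma cell_partition (x : V) (z : Z) :
  cell (x - lat z) <-> z = \row_j Num.floor (x 0 j / p).
Proof.
have H j : (0 <= x 0 j - p * (z 0 j)%:~R < p) = (Num.floor (x 0 j / p) == z 0 j).
  rewrite floor_eq ler_pdivlMr // ltr_pdivrMr // intrD mulr1z (mulrDl (z 0 j)%:~R 1 p) mul1r subr_ge0 ltrBlDr.
  by rewrite ![p * _]mulrC addrC [_ * p + p]addrC.
split=> [c|e j]; last by rewrite !mxE /= in_itv /= H {1}e mxE.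
apply/rowP => j; rewrite mxE; apply/esym/eqP; rewrite -H.
by have := c j; rewrite !mxE /= in_itv.
Qed.

Lemma cell_shift_measurable (v : V) : @measurable _ (borel V) [set x | cell (x + v)].
Proof.
have mf : measurable_fun setT ((fun x : V => x + v) : borel V -> borel V).
  apply: borel_continuous => x; apply: continuousD; [exact: cvg_id | exact: cst_continuous].
by rewrite -[X in measurable X]setTI; apply: mf => //; exact: cell_measurable.
Qed.

Lemma lebm_partition (v : V) (G : set (borel V)) : measurable G ->
  lebm R n G = \esum_(z in [set: Z]) lebm R n (G `&` [set x | cell (x + v - lat z)]).
Proof.
move=> mG.
pose G_ z : set (borel V) := G `&` [set x | cell (x + v - lat z)].
have mG_ z : measurable (G_ z).
  apply: measurableI => //; rewrite (_ : mkset _ = [set x | cell (x + (v - lat z))]).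
    exact: cell_shift_measurable.
  by apply/seteqP; split=> x; rewrite /= addrA.
pose F i : set (borel V) := if pickle_inv i is Some z then G_ z else set0.
have GF : G = \bigcup_i F i.
  apply/seteqP; split=> [x Gx|x [i _]]; last by rewrite /F; case: pickle_inv => // z [].
  exists (choice.pickle (\row_j Num.floor ((x + v) 0 j / p) : Z)) => //.
  by rewrite /F pickleK_inv; split=> //; apply/cell_partition.
rewrite [in LHS]GF measure_bigcup //.
- under eq_eseriesl do rewrite in_setT.
  apply: nneseries_unpickle => // i; rewrite /F.
  by case: pickle_inv => [z|]; rewrite ?in_setT ?measure0.
- by move=> i _; rewrite /F; case: pickle_inv.
- move=> i j _ _ [x []]; rewrite /F.
  case ei : (pickle_inv i) => [z|] // -[_ /cell_partition zE].
  case ej : (pickle_inv j) => [w|] // -[_ /cell_partition wE].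
  have := pickle_invK (T := Z) i; have := pickle_invK (T := Z) j.
  by rewrite ei ej /= zE wE => -> ->.
Qed.

Let pn_ge0 : 0 <= (p ^+ n)^-1. Proof. by rewrite invr_ge0 exprn_ge0 // ltW. Qed.

(** The uniform probability measure on the fundamental cell. *)
Definition cellm : {measure set (borel V) -> \bar R} :=
  mscale (NngNum pn_ge0) [the {measure set (borel V) -> \bar R} of mrestr (lebm R n) cell_measurable].

Lemma cellmE (B : set V) : cellm B = (((p ^+ n)^-1)%:E * lebm R n (B `&` cell))%E.
Proof. by []. Qed.

Lemma cellmT : cellm setT = 1%E.
Proof.
rewrite cellmE setTI lebm_cell -EFinM mulVf //.
by rewrite expf_neq0 // gt_eqF.
Qed.

Lemma cellm_le1 (B : set (borel V)) : measurable B -> (cellm B <= 1)%E.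
Proof. by move=> mB; rewrite -cellmT; apply: le_measure; rewrite ?inE. Qed.

Definition place (A : {fset idx}) (x : V) : I := translate x (packset A).

Lemma place_continuous A : continuous (place A).
Proof. exact: continuous_translate_vec. Qed.

Lemma place_measurable A : measurable_fun setT (place A : borel V -> borel I).
Proof. by apply: (@borel_continuous V I); exact: place_continuous. Qed.

Lemma placeE A x : small A -> place A x = [fset (y + x)%R | y in packpts A]%fset :> {fset _}.
Proof. by move=> sA; rewrite /place translateE packsetE. Qed.

Lemma card_place A x : small A -> #|` place A x| = #|` A|.
Proof.
move=> sA; rewrite placeE // card_imfset /=; last exact: addIr.
exact: card_packpts.
Qed.

Lemma place_preimage_measurable A (B : set (borel I)) : measurable B ->
  @measurable _ (borel V) (place A @^-1` B).
Proof.
by move=> mB; rewrite -[X in measurable X]setTI; apply: place_measurable.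
Qed.

(* For a uniform x in a fundamental cell, the expected number of finite subsets of
   size at most 2t of the packing S0 + p Z^n + x that lie in a given set. *)
Definition periodic_seq (i : nat) : {measure set (borel I) -> \bar R} :=
  if pickle_inv i is Some A then
    if A \in small then pushm cellm (place_measurable A) else [the {measure set (borel I) -> \bar R} of mzero]
  else [the {measure set (borel I) -> \bar R} of mzero].

Definition periodic_measure : {measure set (borel I) -> \bar R} :=
  [the {measure set (borel I) -> \bar R} of mseries periodic_seq 0].

Lemma periodic_measureE (B : set I) :
  periodic_measure B = \esum_(A in small) cellm (place A @^-1` B).
Proof.
rewrite -[LHS]/(\sum_(0 <= k <oo) periodic_seq k B)%E.
apply: nneseries_unpickle => // i; rewrite /periodic_seq.
case: pickle_inv => [A|] //; by case: ifP.
Qed.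

Lemma ge0_integral_periodic (f : I -> \bar R) : (forall S, 0 <= f S)%E ->
  measurable_fun setT (f : borel I -> \bar R) ->
  (\int[periodic_measure]_S f S = \esum_(A in small) \int[cellm]_x f (place A x))%E.
Proof.
move=> f0 mf; rewrite ge0_integral_measure_series //.
apply: nneseries_unpickle => [A _|i]; first exact: integral_ge0.
rewrite /periodic_seq; case: pickle_inv => [A|]; last by rewrite integral_measure_zero.
case: ifP => _; last by rewrite integral_measure_zero.
by rewrite (ge0_integral_pushforward (place_measurable A)).
Qed.

(* Moving x out of the cell by a lattice vector reindexes the subsets A, so the
   measure does not see which fundamental cell is used. *)
Definition shiftidx (z : Z) (A : {fset idx}) : {fset idx} :=
  [fset ((a.1 + z)%R, a.2) | a in A]%fset.

Lemma shiftidxK z : cancel (shiftidx z) (shiftidx (- z)).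
Proof.
move=> A; rewrite /shiftidx -imfset_comp /=; apply/fsetP => -[w i].
apply/imfsetP/idP => [[[w' i'] /= h]|h].
  by rewrite addrK => -[-> ->].
by exists (w, i) => //=; rewrite addrK.
Qed.

Lemma shiftidx_bij z : set_bij small small (shiftidx z).
Proof.
have cE w A : #|` shiftidx w A| = #|` A|.
  by rewrite card_imfset // => -[a i] [b j] /= [/addIr -> ->].
split.
- by move=> A; rewrite /small /= cE.
- by move=> A B _ _; exact: (can_inj (shiftidxK z)).
- move=> A sA; exists (shiftidx (- z) A); first by rewrite /small /= cE.
  by have := shiftidxK (- z) A; rewrite opprK.
Qed.

Lemma small_shiftidx z A : small A -> small (shiftidx z A).
Proof. by have [h _ _] := shiftidx_bij z; exact: h. Qed.

Lemma place_shiftidx z A x : small A -> place (shiftidx z A) x = place A (x + lat z).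
Proof.
move=> sA; apply: val_inj; rewrite -[LHS]/(place (shiftidx z A) x : {fset _}).
rewrite -[RHS]/(place A (x + lat z) : {fset _}) !placeE //; last exact: small_shiftidx.
rewrite /packpts /shiftidx -!imfset_comp /=.
apply: eq_imfset => // a /=; rewrite /pt /= latD.
by rewrite -!addrA; congr (_ + _); rewrite addrC -addrA.
Qed.

(** Both cells are fundamental domains. The shifted one is cut along the lattice translates of
    [cell], each piece is moved back by a lattice vector at the cost of reindexing A, and the pieces
    reassemble to [cell]. *)
Lemma sum_cell_shift (v : V) (B : set (borel I)) : measurable B ->
  (\esum_(A in small) lebm R n (place A @^-1` B `&` [set x | cell (x + v)%R]) =
   \esum_(A in small) lebm R n (place A @^-1` B `&` cell))%E.
Proof.
move=> mB.
have mE A : @measurable _ (borel V) (place A @^-1` B) by exact: place_preimage_measurable.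
have mEs A w : @measurable _ (borel V) (place A @^-1` B `&` [set x | cell (x + w)]).
  by apply: measurableI => //; exact: cell_shift_measurable.
have mEc A : @measurable _ (borel V) (place A @^-1` B `&` cell).
  by apply: measurableI => //; exact: cell_measurable.
pose g A z := lebm R n ((place A @^-1` B `&` cell) `&` [set x | cell (x + v - lat z)]).
have g0 A z : (0 <= g A z)%E by exact: measure_ge0.
have step A : small A -> lebm R n (place A @^-1` B `&` [set x | cell (x + v)]) =
    \esum_(z in [set: Z]) g (shiftidx z A) (- z).
  move=> sA; rewrite (lebm_partition 0 (mEs A v)); apply: eq_esum => z _.
  rewrite -(lebm_shift (lat z)); last first.
    apply: measurableI => //; rewrite (_ : mkset _ = [set x | cell (x + (0 - lat z))]).
      exact: cell_shift_measurable.
    by apply/seteqP; split=> x; rewrite /= addrA.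
  congr (lebm R n _); apply/seteqP; split=> x /=; rewrite place_shiftidx // addr0 addrK latN opprK.
    by move=> [[h1 h2] h3]; do 2?split => //; rewrite addrAC.
  by move=> [[h1 h2] h3]; do 2?split => //; rewrite addrAC.
transitivity (\esum_(A in small) \esum_(z in [set: Z]) g (shiftidx z A) (- z)).
  exact: eq_esum.
rewrite esum_esum //.
transitivity (\esum_(k in [set: Z] `*`` (fun _ => small)) g (shiftidx k.1 k.2) (- k.1)).
  apply: (@reindex_esum _ _ _ _ _ (fun k => (k.2, k.1)) (fun k => g (shiftidx k.2 k.1) (- k.2))).
  split=> [[z A] [] //|[z A] [w B'] _ _ [-> ->] //|[A z] [sA _]].
  by exists (z, A).
rewrite -(@esum_esum _ _ _ _ _ (fun z A => g (shiftidx z A) (- z))) //.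
transitivity (\esum_(z in [set: Z]) \esum_(A in small) g A (- z)).
  apply: eq_esum => z _; apply/esym.
  exact: (@reindex_esum _ _ _ _ _ (shiftidx z) (fun A => g A (- z)) (shiftidx_bij z)).
rewrite esum_esum //.
transitivity (\esum_(k in small `*`` (fun _ => [set: Z])) g k.1 (- k.2)).
  apply: (@reindex_esum _ _ _ _ _ (fun k => (k.2, k.1)) (fun k => g k.2 (- k.1))).
  split=> [[z A] [] //|[z A] [w B'] _ _ [-> ->] //|[A z] [_ sA]].
  by exists (z, A).
rewrite -(@esum_esum _ _ _ _ _ (fun A z => g A (- z))) //.
apply: eq_esum => A sA; rewrite [RHS](lebm_partition v (mEc A)).
apply/esym; apply: (@reindex_esum _ _ _ _ _ (fun z => - z) (fun z => g A z)).
by split.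
Qed.

Lemma esum_cellm (T : choiceType) (D : set T) (E : T -> set (borel V)) :
  (\esum_(A in D) cellm (E A) = ((p ^+ n)^-1)%:E * (\esum_(A in D) lebm R n (E A `&` cell)))%E.
Proof. by rewrite esum_pZl // invr_gt0 exprn_gt0. Qed.

Lemma translateK v : cancel (@translate R n (2 * t) v) (translate (- v)).
Proof.
move=> S; apply: val_inj; rewrite /= -imfset_comp /=; apply/fsetP => y.
apply/imfsetP/idP => [[z /= zS ->]|yS]; first by rewrite addrK.
by exists y => //=; rewrite addrK.
Qed.

Lemma place_translate A v x : small A -> translate v (place A x) = place A (x + v).
Proof.
move=> sA; apply: val_inj; rewrite /= -imfset_comp /=; apply: eq_imfset => // y /=.
by rewrite addrA.
Qed.

(** Translating the sets by v amounts to replacing x by x + v, hence to integrating over a shifted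
    fundamental cell. *)
Lemma periodic_invariant : translation_invariant periodic_measure.
Proof.
move=> v B mB; rewrite !periodic_measureE !esum_cellm -(sum_cell_shift v mB); congr (_ * _)%E.
have imE : translate v @` B = translate (- v) @^-1` B.
  apply/seteqP; split=> [_ [S BS <-]|S BS]; first by rewrite /= translateK.
  by exists (translate (- v) S) => //; rewrite -{1}(opprK v) translateK.
have mvB : measurable (translate v @` B : set (borel I)).
  rewrite imE -[X in measurable X]setTI.
  by apply: (borel_continuous (@continuous_translate R n (2 * t) (- v))).
apply: eq_esum => A sA; rewrite -(lebm_shift v); last first.
  by apply: measurableI; [exact: place_preimage_measurable | exact: cell_measurable].
congr (lebm R n _); rewrite imE.
by apply/seteqP; split=> x /= [h1 h2]; split=> //; move: h1; rewrite place_translate // addrK.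
Qed.

(** Since x stays in one bounded cell, only finitely many packing points can reach the window,
    whatever x is. Sums over A thereby become finite. *)
Lemma near_idx (r : R) : exists X : {fset idx}, forall a x, cell x -> cbox 0 r (pt a + x) ->
  a \in X.
Proof.
(* In p z + s + x the total is at most r in absolute value, s lies in [0, l] and x in [0, p[; as p
   >= 1, this bounds |z|. Coordinates between -M and M are then encoded as ordinals below 2M + 1. *)
pose M := Num.bound (`|r| + l + p).
pose J : finType := ({ffun 'I_n -> 'I_(2 * M).+1} * 'I_m)%type.
pose g (f : J) : idx := (\row_j ((f.1 j : nat)%:Z - M%:Z), f.2).
exists [fset g f | f in J]%fset => -[z i] x cx cb.
have zM j : `|z 0 j| < M%:Z.
  have := cb 0 j; have := cx j; rewrite /pt /= !mxE /= in_itv /= sub0r normrN.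
  have /andP[s1 s2] := S0l (nthS0 i) j; set s := nth 0 S0 i 0 j in s1 s2 *.
  move=> /andP[x1 x2] h.
  have h1 : p * `|(z 0 j)%:~R| <= `|r| + l + p.
    rewrite -{1}(gtr0_norm p0) -normrM (_ : p * _ = (p * (z 0 j)%:~R + s + x 0 j) - (s + x 0 j)); last by ring.
    apply: le_trans (ler_normB _ _) _; rewrite -[leRHS]addrA; apply: lerD.
      by apply: le_trans h _; exact: ler_norm.
    by rewrite ger0_norm ?addr_ge0 // lerD // ltW.
  rewrite -(ltr_int R) intr_norm; apply: le_lt_trans (archi_boundP _); last first.
    by rewrite !addr_ge0 // ltW.
  apply: le_trans h1; rewrite ler_peMl // /p; move: l0; lra.
have kP j : (`|(z 0 j + M%:Z)%R|%N < (2 * M).+1)%N.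
  have := zM j; rewrite ltr_norml => /andP[z1 z2]; lia.
apply/imfsetP; exists ([ffun j => Ordinal (kP j)], i) => //=; rewrite /g /=.
congr pair; apply/rowP => j; rewrite !mxE ffunE /=.
have := zM j; rewrite ltr_norml => /andP[z1 z2]; lia.
Qed.

Definition smallsub (X : {fset idx}) : seq {fset idx} :=
  [seq A <- fpowerset X | (#|` A| <= 2 * t)%N].

Lemma smallsub_uniq X : uniq (smallsub X).
Proof. by rewrite filter_uniq // fset_uniq. Qed.

Lemma near_place (r : R) : exists X : {fset idx}, forall A x, small A -> cell x ->
  (forall y, y \in (place A x : {fset _}) -> cbox 0 r y) -> A \in smallsub X.
Proof.
have [X XP] := near_idx r; exists X => A x sA cx h.
rewrite mem_filter sA fpowersetE; apply/fsubsetP => a aA; apply: XP cx _; apply: h.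
rewrite placeE //; apply/imfsetP; exists (pt a) => //.
by apply/imfsetP; exists a.
Qed.

Lemma smallsub_small X : [set` smallsub X] `<=` small.
Proof. by move=> A /=; rewrite mem_filter => /andP[]. Qed.

Lemma cellm_eq0 (B : set V) : B `&` cell = set0 -> cellm B = 0%E.
Proof. by move=> e; rewrite cellmE e measure0 mule0. Qed.

(** Only finitely many A contribute, each with mass at most 1. *)
Lemma periodic_bounded (r : R) (B : set (borel I)) : measurable B ->
  (forall S, B S -> forall y, y \in (S : {fset _}) -> cbox 0 r y) ->
  (periodic_measure B < +oo)%E.
Proof.
move=> mB Br; have [X XP] := near_place r.
rewrite periodic_measureE (@esum_support _ _ _ [set` smallsub X]) //; first last.
- move=> A sA nA; apply: cellm_eq0; apply/seteqP; split=> // x [/= /Br h cx].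
  by apply: nA; exact: XP cx h.
- exact: smallsub_small.
rewrite esum_seq ?smallsub_uniq //; apply: lte_sum_pinfty => A _.
apply: le_lt_trans (ltry 1); apply: cellm_le1.
exact: place_preimage_measurable.
Qed.

Lemma periodic_radon : radon periodic_measure.
Proof.
pose O (i : nat) := [set S : I | \sum_(x <- (S : {fset _})) `|x| < i%:R].
have oO i : open (O i).
  apply: (@open_comp _ _ (fun S : I => \sum_(x <- (S : {fset _})) `|x|) [set x | x < i%:R]).
    by move=> S _; apply: continuous_indepset_sum; exact: norm_continuous.
  exact: open_lt.
apply: (radonP _ _ oO).
- exact: indepset_hausdorff.
- exact: indepset_open_sigma_compact.
- move=> i; apply: (@periodic_bounded i%:R); first exact: borel_open.
  by move=> S; exact: norm_sum_cbox.
- move=> Q /compact_indepset_bounded[r rP]; exists (Num.bound `|r|) => S /rP h.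
  by apply: lt_trans h _; apply: le_lt_trans (ler_norm _) _; exact: archi_boundP.
Qed.

Lemma periodic_empty : periodic_measure [set indepset0 R n (2 * t)] = 1%E.
Proof.
rewrite periodic_measureE (@esum_support _ _ _ [set fset0]) //; first last.
- move=> A sA A0; rewrite (_ : _ @^-1` _ = set0) ?measure0 //; apply/seteqP; split=> // x /= e.
  by apply: A0; apply: cardfs0_eq; rewrite -(card_place x sA) e; exact: cardfs0.
- by move=> A ->.
rewrite esum_set1 // (_ : _ @^-1` _ = setT) ?cellmT //; apply/seteqP; split=> // x _ /=.
have s0 : small fset0 by [].
apply: val_inj; rewrite -[LHS]/(place fset0 x : {fset _}) placeE //= /packpts !imfset0 //.
Qed.

(** For each point of [S0], summing over the lattice unfolds the integral over one cell into the
    Lebesgue measure of all of [B]; there are [m] such points. *)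
Lemma periodic_singletons (B : set (borel V)) : (1 <= t)%N -> measurable B ->
  periodic_measure [set S : I | exists2 x, B x & (S : {fset V}) = [fset x]%fset] =
  ((m%:R / p ^+ n)%:E * lebesgue_rV B)%E.
Proof.
move=> t1 mB; rewrite lebmE.
have s1 a : small [fset a]%fset by rewrite /small /= cardfs1 muln_gt0.
have place1 a x : (place [fset a]%fset x : {fset V}) = [fset (x + pt a)%R]%fset.
  rewrite placeE //; apply/fsetP => y; rewrite in_fset1.
  apply/imfsetP/eqP => [[w /= /imfsetP[b /=]]|->].
    by rewrite in_fset1 => /eqP -> -> ->; rewrite addrC.
  exists (pt a); last by rewrite addrC.
  by apply/imfsetP; exists a => //; rewrite inE.
have mBs (w : V) : @measurable _ (borel V) [set x | B (x + w)].
  have mf : measurable_fun setT ((fun x : V => x + w) : borel V -> borel V).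
    apply: borel_continuous => x; apply: continuousD; [exact: cvg_id | exact: cst_continuous].
  by rewrite -[X in measurable X]setTI; apply: mf.
rewrite periodic_measureE (@esum_support _ _ _ [set [fset a]%fset | a in [set: idx]]) //; first last.
- move=> A sA nA; rewrite (_ : _ @^-1` _ = set0) ?measure0 //; apply/seteqP; split=> // x [y _ e].
  have /eqP/cardfs1P[a Aa] : #|` A| = 1%N by rewrite -(card_place x sA) e cardfs1.
  by apply: nA; exists a.
- by move=> _ [a _ <-]; exact: s1.
rewrite esum_image; last by move=> a b _ _; exact: fset1_inj.
rewrite esum_cellm.
transitivity (((p ^+ n)^-1)%:E * (\esum_(k in [set: 'I_m] `*`` (fun _ => [set: Z]))
    lebm R n ([set x | B (x + pt (k.2, k.1))%R] `&` cell)))%E.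
  congr (_ * _)%E.
  rewrite (@reindex_esum _ _ _ ([set: 'I_m] `*`` (fun _ => [set: Z])) _ (fun k => (k.2, k.1))).
    apply: eq_esum => -[i z] _; congr (lebm R n _); congr (_ `&` _).
    apply/seteqP; split=> [x [y By e]|x Bx].
      have {}e : (place [fset (z, i)]%fset x : {fset V}) = [fset y]%fset := e.
      by move: e By; rewrite place1 => /fset1_inj <-.
    by exists (x + pt (z, i)); last exact: place1.
  split=> // [[i z] [j w] _ _ [-> ->] //|[z i] _].
  by exists (i, z).
rewrite -(@esum_esum _ _ _ _ _ (fun i z => lebm R n ([set x | B (x + pt (z, i))] `&` cell))) //.
rewrite (@eq_esum _ _ _ _ (fun _ => lebm R n B)); last first.
  move=> i _; rewrite -(lebm_shift (nth 0 S0 i) mB) (lebm_partition 0 (mBs _)).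
  apply: eq_esum => z _; rewrite -(lebm_shift (- lat z)); last first.
    by apply: measurableI => //; exact: cell_measurable.
  congr (lebm R n _); apply/seteqP; split=> x /= [];
    by rewrite /pt /= addr0 addrA subrK.
rewrite (_ : [set: 'I_m] = [set` enum 'I_m]); last first.
  by apply/seteqP; split=> i _ //=; rewrite mem_enum.
have sum_cst k (x : \bar R) : (\sum_(i < k) x = k%:R%:E * x)%E.
  elim: k => [|k IH]; first by rewrite big_ord0 mul0e.
  by rewrite big_ord_recr /= IH -natr1 EFinD ge0_muleDl ?mul1e ?lee_fin ?ler0n.
by rewrite esum_seq ?enum_uniq // big_enum /= sum_cst muleA -EFinM mulrC.
Qed.

Lemma periodic_hat0 : (1 <= t)%N -> hat0 periodic_measure = m%:R / p ^+ n.
Proof.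
move=> t1; rewrite /hat0.
set P := (X in xget 0 X).
have Pm : P (m%:R / p ^+ n) by move=> B mB; exact: periodic_singletons.
(* The cell has positive finite volume, so it determines the multiple. *)
have /(_ cell cell_measurable) := @xgetPex _ 0 P (ex_intro _ _ Pm).
rewrite (Pm cell cell_measurable) lebmE lebm_cell -!EFinM => -[].
by move/mulIf => ->//; rewrite expf_neq0 // gt_eqF.
Qed.

Lemma cellm_integral_eq0 (f : V -> \bar R) : (forall x, 0 <= f x)%E ->
  measurable_fun setT (f : borel V -> \bar R) -> (forall x, cell x -> f x = 0%E) ->
  (\int[cellm]_x f x = 0)%E.
Proof.
move=> f0 mf fc; have mc := cell_measurable.
have mnc : @measurable _ (borel V) (~` cell) by exact: measurableC.
rewrite -(setUv cell) ge0_integral_setU //; last 2 first.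
- by rewrite setUv.
- by apply/disj_set2P; rewrite setICr.
rewrite integral0_eq // add0e; apply: null_set_integral => //; first exact: measurable_funTS.
by apply: cellm_eq0; rewrite setICl.
Qed.

(** Positivity already holds at each fixed translate x, where [A_op_sum] turns the sum into a
    quadratic form of K on subsets of a finite independent set. *)
Lemma sum_smallsub_ge0 (K : indepset R n t * indepset R n t -> R) X x : psd_kernel K ->
  0 <= \sum_(A <- smallsub X) A_op K (place A x).
Proof.
move=> psd; pose h (a : idx) := pt a + x.
have hi : injective h by move=> a b /addIr/pt_inj.
have iX : independent (h @` X)%fset.
  move=> _ _ /imfsetP[a _ ->] /imfsetP[b _ ->] ab; rewrite /h edistDr; apply: pt_sep.
  by apply: contra_neq ab => ->.
have := psd_sum_ge0 iX psd; rewrite -A_op_sum // big_fpowerset_imfset //.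
rewrite /smallsub big_filter; under [in X in X -> _]eq_bigl do rewrite card_imfset //=.
rewrite big_seq_cond [X in _ -> 0 <= X]big_seq_cond.
rewrite (eq_bigr (fun A => A_op K (place A x))) // => A /andP[_ sA].
congr (A_op K _); apply: val_inj; rewrite -[RHS]/(place A x : {fset _}) placeE //.
have iA : independent (h @` A)%fset.
  move=> _ _ /imfsetP[a _ ->] /imfsetP[b _ ->] ab; rewrite /h edistDr; apply: pt_sep.
  by apply: contra_neq ab => ->.
rewrite -[LHS]/(toindep (2 * t) (h @` A)%fset : {fset _}) toindepK //; last by rewrite card_imfset.
by rewrite /packpts -imfset_comp.
Qed.

Section positivity.
Variable K : indepset R n t * indepset R n t -> R.
Hypotheses (cK : continuous K) (sK : compactly_supported K) (psdK : psd_kernel K).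

Let kernel_bounded : exists r : R, forall q, K q != 0 ->
  (forall x, x \in (q.1 : {fset _}) -> cbox 0 r x) /\
  (forall x, x \in (q.2 : {fset _}) -> cbox 0 r x).
Proof.
have cfst : compact (fst @` closure [set q | K q != 0]).
  by apply: continuous_compact sK; apply: continuous_subspaceT => q; exact: cvg_fst.
have csnd : compact (snd @` closure [set q | K q != 0]).
  by apply: continuous_compact sK; apply: continuous_subspaceT => q; exact: cvg_snd.
have [r1 r1P] := compact_indepset_bounded cfst.
have [r2 r2P] := compact_indepset_bounded csnd.
exists (Num.max r1 r2) => q qK; have Cq := @subset_closure _ [set q | K q != 0] q qK.
split; apply: norm_sum_cbox; rewrite lt_max; apply/orP; [left | right].
  by apply: r1P; exists q.
by apply: r2P; exists q.
Qed.

Lemma periodic_psd : (0 <= \int[periodic_measure]_S (A_op K S)%:E)%E.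
Proof.
have [r rP] := kernel_bounded; have [X XP] := near_place r.
pose G := @A_op R n t K; have cG : continuous G by exact: A_op_continuous.
have GP S : G S != 0 -> forall x, x \in (S : {fset _}) -> cbox 0 r x.
  by apply: A_op_support => q qK; exact: rP.
have [M GM] : exists M, forall S, `|G S| <= M.
  have /compact_bounded[M [_ MP]] :=
    continuous_compact (continuous_subspaceT cG) (@compact_subcube R n (2 * t) 0 r).
  exists (Num.max 0 (M + 1)) => S; rewrite le_max; have [->|GS] := eqVneq (G S) 0.
    by rewrite normr0 lexx.
  apply/orP; right; apply: (MP (M + 1) ltac:(by rewrite ltrDl)); exists S => //.
  by move=> x; exact: GP.
have M0 : 0 <= M by apply: le_trans (GM point); exact: normr_ge0.
(* Positive and negative parts of A_t K are treated alike: for each, the finite window reduces the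
   integral to one finite sum integrated over the cell. *)
have key (g : I -> R) : continuous g -> (forall S, 0 <= g S) ->
    (forall S, g S != 0 -> G S != 0) ->
    (\int[periodic_measure]_S (g S)%:E =
     \int[cellm]_x (\sum_(A <- smallsub X) g (place A x))%R%:E)%E.
  move=> cg g0 gG.
  have mg A : measurable_fun setT (fun x : borel V => (g (place A x))%:E).
    apply/measurable_EFinP; apply: (@borel_continuous_real _ V) => x.
    by apply: continuous_comp; [exact: place_continuous | exact: cg].
  rewrite ge0_integral_periodic; last 2 first.
  - by move=> S; rewrite lee_fin.
  - by apply/measurable_EFinP; exact: borel_continuous_real.
  rewrite (@esum_support _ _ _ [set` smallsub X]); first last.
  - move=> A sA nA; apply: cellm_integral_eq0 => [x||x cx]; [by rewrite lee_fin | exact: mg |].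
    congr EFin; apply/eqP/negPn/negP => /gG/GP h; apply: nA; exact: XP cx h.
  - by move=> A _; apply: integral_ge0 => x _; rewrite lee_fin.
  - exact: smallsub_small.
  rewrite esum_seq ?smallsub_uniq //; last first.
    by move=> A; apply: integral_ge0 => x _; rewrite lee_fin.
  rewrite -ge0_integral_sum //; last by move=> A x _; rewrite lee_fin.
  by apply: eq_integral => x _; rewrite sumEFin.
pose gp S := Num.max (G S) 0; pose gm S := Num.max (- G S) 0.
have cgp : continuous gp by apply: cont_max => //; exact: cst_continuous.
have cgm : continuous gm.
  apply: cont_max; last exact: cst_continuous.
  by move=> S; apply: continuousN; exact: cG.
rewrite integralE.
have -> : (\int[periodic_measure]_S (fun S => (A_op K S)%:E)^\+ S =
    \int[periodic_measure]_S (gp S)%:E)%E.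
  by apply: eq_integral => S _; rewrite funeposE /gp EFin_max.
have -> : (\int[periodic_measure]_S (fun S => (A_op K S)%:E)^\- S =
    \int[periodic_measure]_S (gm S)%:E)%E.
  by apply: eq_integral => S _; rewrite funenegE /gm EFin_max EFinN.
rewrite !key //; last 4 first.
- by move=> S; rewrite /gm le_max lexx orbT.
- by move=> S; apply: contraNneq => e; rewrite /gm e oppr0 maxxx.
- by move=> S; rewrite /gp le_max lexx orbT.
- by move=> S; apply: contraNneq => e; rewrite /gp e maxxx.
have mH (g : I -> R) : continuous g ->
    measurable_fun setT (fun x : borel V => (\sum_(A <- smallsub X) g (place A x))%R%:E).
  move=> cg; apply/measurable_EFinP; apply: (@borel_continuous_real _ V).
  apply: continuous_sumr => A _ x.
  by apply: continuous_comp; [exact: place_continuous | exact: cg].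
(* The negative part has a finite integral, being at most M for each of finitely many A on a
   probability space; the two parts may then be compared pointwise in x. *)
rewrite sube_ge0; last first.
  apply/orP; left; rewrite ge0_fin_numE; last first.
    by apply: integral_ge0 => x _; rewrite lee_fin sumr_ge0 // => A _; rewrite /gm le_max lexx orbT.
  apply: (@le_lt_trans _ _ (\int[cellm]_x (cst ((size (smallsub X))%:R * M)%:E x))%E).
    apply: ge0_le_integral => //.
    - by move=> x _; rewrite lee_fin sumr_ge0 // => A _; rewrite /gm le_max lexx orbT.
    - exact: mH.
    - move=> x _; rewrite lee_fin /=.
      apply: (@le_trans _ _ (\sum_(A <- smallsub X) M)).
        apply: ler_sum => A _; rewrite /gm ge_max M0 andbT.
        by apply: le_trans (GM (place A x)); rewrite -normrN; exact: ler_norm.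
      by rewrite big_const_seq count_predT iter_addr_0 mulr_natl.
  by rewrite integral_cst // cellmT mule1 ltry.
apply: ge0_le_integral => //.
- by move=> x _; rewrite lee_fin sumr_ge0 // => A _; rewrite /gm le_max lexx orbT.
- exact: mH.
- exact: mH.
move=> x _; rewrite lee_fin -subr_ge0 -sumrB.
rewrite (eq_bigr (fun A => G (place A x))) ?sum_smallsub_ge0 // => A _.
rewrite /gp /gm; set a := G _; case: (leP 0 a) => a0.
  by rewrite max_r ?subr0 // oppr_le0.
by rewrite max_l ?sub0r ?opprK // oppr_ge0 ltW.
Qed.

End positivity.

Lemma periodic_feasible : las_feasible periodic_measure.
Proof.
split; [exact: periodic_radon|exact: periodic_invariant|exact: periodic_empty|].
exact: periodic_psd.
Qed.

End periodic_packing.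

(** * Density and convergence *)

Section main.
Variables (R : realType) (n : nat).
Hypothesis n1 : (1 <= n)%N.

Let C k : set 'rV[R]_n := [set 2 ^+ k *: x | x in unit_cube R n].

Lemma scaled_cubeP k (x : 'rV[R]_n) : C k x <-> forall i, 0 <= x 0 i <= 2 ^+ k.
Proof.
have k0 : 0 < 2 ^+ k :> R by rewrite exprn_gt0.
split=> [[y y1 <-] i|x1].
  have /andP[y2 y3] := y1 i; rewrite mxE mulr_ge0 ?(ltW k0) //=.
  by rewrite -[leRHS]mulr1 ler_pM2l.
exists ((2 ^+ k)^-1 *: x); last by rewrite scalerA divff ?scale1r // gt_eqF.
move=> i; have /andP[x2 x3] := x1 i.
by rewrite mxE mulrC divr_ge0 ?(ltW k0) //= ler_pdivrMr // mul1r.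
Qed.

(* Two points whose coordinates agree after rounding to multiples of 1/n are at
   distance less than 1, so an independent set meets each cell at most once. *)
Lemma card_independent_bounded (L : R) : exists M : nat, forall S : {fset 'rV[R]_n},
  independent S -> (forall x, x \in S -> forall i, 0 <= x 0 i <= L) -> (#|` S| <= M)%N.
Proof.
have n0 : 0 < n%:R :> R by rewrite ltr0n.
pose B := Num.bound (n%:R * `|L|).
pose f (x : 'rV[R]_n) : {ffun 'I_n -> 'I_B.+1} := [ffun i => inord (Num.truncn (n%:R * x 0 i))].
exists #|{: {ffun 'I_n -> 'I_B.+1}}| => S iS SL.
have finj : {in S &, injective f}.
  move=> x y xS yS fxy; apply/eqP/negPn/negP => xy; have := iS x y xS yS xy.
  apply/negP; rewrite -ltNge.
  have H i : (x 0 i - y 0 i) ^+ 2 <= n%:R^-1.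
    have /andP[x0 xL] := SL x xS i; have /andP[y0 yL] := SL y yS i.
    have := congr1 (fun g : {ffun 'I_n -> 'I_B.+1} => val (g i)) fxy; rewrite !ffunE /=.
    have tr z : 0 <= z -> z <= L -> (Num.truncn (n%:R * z) < B.+1)%N.
      move=> z0 zL; have /andP[h _] := truncn_itv (mulr_ge0 (ltW n0) z0).
      rewrite ltnS -(ler_nat R); apply: le_trans h _; apply: le_trans (ltW (archi_boundP _)) => //.
        by rewrite ler_pM2l // (le_trans zL) // ler_norm.
    rewrite !inordK ?tr // => e.
    have /andP[h1 h2] := truncn_itv (mulr_ge0 (ltW n0) x0).
    have /andP[h3 h4] := truncn_itv (mulr_ge0 (ltW n0) y0).
    rewrite e in h1 h2; set q := (Num.truncn _)%:R in h1 h3.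
    rewrite -natr1 -/q in h2 h4.
    have d1 : `|x 0 i - y 0 i| <= n%:R^-1.
      rewrite -[leRHS]mul1r ler_pdivlMr // -[X in _ * X](gtr0_norm n0) -normrM mulrBl.
      by rewrite ler_norml; apply/andP; split; rewrite ![_ * n%:R]mulrC; lra.
    rewrite -real_normK ?num_real // expr2.
    apply: (@le_trans _ _ (1 * n%:R^-1)); last by rewrite mul1r.
    apply: ler_pM => //; apply: le_trans d1 _; rewrite invf_le1 //.
    by rewrite ler1n.
  apply: (@le_lt_trans _ _ (Num.sqrt 1)); last by rewrite sqrtr1 ltr1n.
  rewrite ler_sqrt //; apply: le_trans (ler_sum _ (fun i _ => H i)) _.
  by rewrite sumr_const card_ord -[leLHS]mulr_natr mulVf // gt_eqF.
have u : uniq [seq f x | x <- S] by rewrite map_inj_in_uniq ?fset_uniq.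
by rewrite -[X in (X <= _)%N](size_map f); move/card_uniqP: u => <-; exact: max_card.
Qed.

Let packset_k k : set R := [set (#|` S|)%:R |
  S in [set S : {fset 'rV[R]_n} | [set` S] `<=` C k /\ independent S]].

Lemma pack_has_sup k : has_sup (packset_k k).
Proof.
split.
  exists 0, fset0; last by rewrite cardfs0.
  by split=> [x|x y]; rewrite /= in_fset0.
have [M MP] := card_independent_bounded (2 ^+ k).
exists M%:R => _ [S [SC iS] <-]; rewrite ler_nat; apply: MP => // x xS.
by apply/scaled_cubeP; exact: SC.
Qed.

Lemma le_pack k (S : {fset 'rV[R]_n}) : independent S -> [set` S] `<=` C k ->
  (#|` S|)%:R <= pack (C k).
Proof. by move=> iS SC; apply: sup_upper_bound; [exact: pack_has_sup | exists S]. Qed.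

Lemma pack_le k (y : R) : (forall S : {fset 'rV[R]_n}, independent S -> [set` S] `<=` C k ->
  (#|` S|)%:R <= y) -> pack (C k) <= y.
Proof.
move=> H; apply: ge_sup; first by have [] := pack_has_sup k.
by move=> _ [S [SC iS] <-]; exact: H.
Qed.

Lemma pack_ge0 k : 0 <= pack (C k).
Proof.
have := @le_pack k fset0; rewrite cardfs0; apply; first by move=> x y; rewrite in_fset0.
by move=> x; rewrite /= in_fset0.
Qed.

Lemma las'_upper k t : pack (C k) <= t%:R ->
  (las' R n t <= (pack (C k) / 2 ^+ (k * n))%:E)%E.
Proof.
move=> Nt; apply: ge_ereal_sup => _ [mu feas <-]; rewrite lee_fin.
set L : R := 2 ^+ k; have L0 : 0 < L by rewrite exprn_gt0.
rewrite exprM -/L ler_pdivlMr ?exprn_gt0 //.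
have packN (S : {fset 'rV[R]_n}) : independent S ->
    [set` S] `<=` cbox (const_mx (L / 2)) (L / 2) -> (#|` S|)%:R <= pack (C k).
  move=> iS SC; apply: le_pack => // x /SC xC; apply/scaled_cubeP => i.
  by have := xC 0 i; rewrite !mxE ler_distl => /andP[h1 h2]; apply/andP; split; rewrite -/L; lra.
(* The inner cube [e, L - e]^n fills the cube as e tends to 0 from the right. *)
have c : (fun e : R => hat0 mu * (L - 2 * e) ^+ n) x @[x --> 0^'+] --> hat0 mu * L ^+ n.
  apply: cvg_at_right_filter.
  rewrite -[X in _ * X ^+ _](_ : L - 2 * 0 = L); last by rewrite mulr0 subr0.
  have ca : continuous (fun e : R => hat0 mu * (L - 2 * e) ^+ n).
    have cb : continuous (fun e : R => L - 2 * e).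
      apply: contB; first exact: cst_continuous.
      by apply: contM; [exact: cst_continuous | move=> z; exact: cvg_id].
    apply: contM; first exact: cst_continuous.
    by move=> e; exact: (continuous_comp (cb e) (@exprn_continuous R n _)).
  exact: ca.
apply: cvgr_to_le c _.
have L20 : 0 < L / 2 by rewrite divr_gt0.
near=> e.
have eL : e < L / 2 by near: e; exact: nbhs_right_lt.
exact: (@hat0_inner_le R n t L (pack (C k)) e).
Unshelve. all: by end_near. Qed.

Lemma las'_lower_set k t (S : {fset 'rV[R]_n}) : (1 <= t)%N -> independent S ->
  [set` S] `<=` C k -> (((#|` S|)%:R / (2 ^+ k + 2) ^+ n)%:E <= las' R n t)%E.
Proof.
move=> t1 iS SC.
have L0 : 0 <= 2 ^+ k :> R by rewrite exprn_ge0.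
have SL s : s \in S -> forall i, 0 <= s 0 i <= 2 ^+ k by move=> /SC/scaled_cubeP.
apply: ereal_sup_ubound; exists (periodic_measure S t L0); first exact: periodic_feasible.
by rewrite periodic_hat0.
Qed.

Let dens k : R := pack (C k) / 2 ^+ (k * n).
Let ratio k : R := (1 + 2 / 2 ^+ k) ^+ n.

Lemma dens_ratio k : dens k = pack (C k) / (2 ^+ k + 2) ^+ n * ratio k.
Proof.
have k0 : 0 < 2 ^+ k :> R by rewrite exprn_gt0.
have k2 : 0 < 2 ^+ k + 2 :> R by rewrite addr_gt0.
rewrite /dens /ratio exprM -mulrA; congr (_ * _).
move: (2 ^+ k) k0 k2 => u u0 u2.
have -> : 1 + 2 / u = (u + 2) / u by field; rewrite gt_eqF.
by rewrite expr_div_n mulrA mulVf ?mul1r // expf_neq0 // gt_eqF.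
Qed.

Lemma ratio_ge1 k : 1 <= ratio k.
Proof. by rewrite exprn_ege1 // lerDl divr_ge0 // exprn_ge0. Qed.

Lemma ratio_cvg : ratio k @[k --> \oo] --> (1 : R).
Proof.
have h : `|2^-1| < 1 :> R by rewrite ger0_norm ?invr_ge0 // invf_lt1 // ltr1n.
have g : (fun k => 1 + geometric 2 2^-1 k) x @[x --> \oo] --> (1 + 0 : R).
  by apply: cvgD; [exact: cvg_cst | exact: cvg_geometric].
have e : ratio = (fun x : R => x ^+ n) \o (fun k => 1 + geometric 2 2^-1 k).
  by apply/funext => k; rewrite /ratio /geometric /= exprVn.
rewrite e -[X in _ --> X](_ : (1 + 0 : R) ^+ n = 1); last by rewrite addr0 expr1n.
exact: (continuous_cvg _ (@exprn_continuous R n _) g).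
Qed.

Lemma dens_le_las k t (r : R) : (1 <= t)%N -> (las' R n t <= r%:E)%E -> dens k <= r * ratio k.
Proof.
move=> t1 tr; rewrite dens_ratio ler_wpM2r //; first exact: le_trans ler01 (ratio_ge1 k).
have k2 : 0 < (2 ^+ k + 2) ^+ n :> R by rewrite exprn_gt0 // addr_gt0 // exprn_gt0.
rewrite ler_pdivrMr //; apply: pack_le => S iS SC; rewrite -ler_pdivrMr // -lee_fin.
exact: le_trans (las'_lower_set t1 iS SC) tr.
Qed.

Let d := inf (range dens).

Let dens_ge0 k : 0 <= dens k.
Proof. by rewrite divr_ge0 ?pack_ge0 // exprn_ge0. Qed.

Let d_le k : d <= dens k.
Proof. by apply: ge_inf; [exists 0 => _ [j _ <-] | exists k]. Qed.

(** Two unrelated scales are compared through a single value of [las'], at a t exceeding the packing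
    number of the cube of scale j. *)
Lemma dens_le j k : dens k <= dens j * ratio k.
Proof.
pose t := (Num.bound (pack (C j))).+1.
apply: (@dens_le_las k t) => //; apply: las'_upper.
apply: le_trans (ltW (archi_boundP (pack_ge0 j))) _.
by rewrite ler_nat /t.
Qed.

(** Taking the infimum over j in [dens_le] squeezes [dens k] between d and d times [ratio k]. *)
Lemma dens_cvg : dens k @[k --> \oo] --> d.
Proof.
apply: (@squeeze_cvgr _ _ _ _ (cst d) (fun k => d * ratio k)).
- apply: nearW => k /=; rewrite d_le /= -ler_pdivrMr; last exact: lt_le_trans ltr01 (ratio_ge1 k).
  apply: lb_le_inf; first by exists (dens 0%N), 0%N.
  move=> _ [j _ <-]; rewrite ler_pdivrMr ?dens_le //.
  exact: lt_le_trans ltr01 (ratio_ge1 k).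
- exact: cvg_cst.
- by rewrite -[X in _ --> X]mulr1; apply: cvgM; [exact: cvg_cst | exact: ratio_cvg].
Qed.

Lemma delta_packE : delta_pack R n = d.
Proof. by apply: cvg_lim => //; exact: dens_cvg. Qed.

Lemma delta_pack_le_las t : (1 <= t)%N -> ((delta_pack R n)%:E <= las' R n t)%E.
Proof.
move=> t1; rewrite delta_packE.
(* The empty packing excludes the value -oo, and for +oo the claim is immediate, so a real value
   remains. *)
have : (0%:E <= las' R n t)%E.
  have := @las'_lower_set 0 t fset0 t1; rewrite cardfs0 mul0r; apply.
    by move=> x y; rewrite in_fset0.
  by move=> x; rewrite /= in_fset0.
case e : (las' R n t) => [r| |] // _; last by rewrite leey.
rewrite lee_fin.
have c : r * ratio k @[k --> \oo] --> r.
  by rewrite -[X in _ --> X]mulr1; apply: cvgM; [exact: cvg_cst | exact: ratio_cvg].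
apply: cvgr_to_ge c _; apply: nearW => k; apply: le_trans (d_le k) _.
by apply: (dens_le_las k t1); rewrite e.
Qed.

Lemma las_cvg : las' R n t @[t --> \oo] --> (delta_pack R n)%:E.
Proof.
have up j : \forall t \near \oo, (las' R n t <= (dens j)%:E)%E.
  exists (Num.bound (pack (C j))) => // t /= jt; apply: las'_upper.
  by apply: le_trans (ltW (archi_boundP (pack_ge0 j))) _; rewrite ler_nat.
have lo : \forall t \near \oo, (d%:E <= las' R n t)%E.
  by exists 1%N => // t /= t1; rewrite -delta_packE; exact: delta_pack_le_las.
(* [las'] is extended-real valued; it is eventually finite, lying between d and [dens 0], and real
   convergence can then be proved. *)
rewrite delta_packE; apply/fine_cvgP; split.
  near=> t; rewrite fin_real //; apply/andP; split.
    by apply: lt_le_trans (ltNyr d) _; near: t; exact: lo.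
  by apply: le_lt_trans (ltry (dens 0%N)); near: t; exact: up.
apply/cvgrPdist_le => e e0.
have [_ [j _ <-] jd] : exists2 x, range dens x & x < d + e.
  by apply: inf_adherent => //; split; [exists (dens 0%N), 0%N | exists 0 => _ [j _ <-]].
near=> t.
have h1 : (d%:E <= las' R n t)%E by near: t; exact: lo.
have h2 : (las' R n t <= (dens j)%:E)%E by near: t; exact: up.
move: h1 h2; rewrite /=; case: (las' R n t) => [r| |] //=; rewrite !lee_fin => h1 h2.
rewrite distrC ger0_norm ?subr_ge0 // lerBlDl.
by apply: le_trans h2 (ltW jd).
Unshelve. all: by end_near. Qed.

End main.

Theorem corollary6p17 (R : realType) (n : nat) (hn : (1 <= n)%N) :
  (forall t : nat, (1 <= t)%N -> ((delta_pack R n)%:E <= las' R n t)%E) /\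
  las' R n t @[t --> \oo] --> (delta_pack R n)%:E.
Proof. by split=> [t|]; [exact: delta_pack_le_las | exact: las_cvg]. Qed.
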